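(* Let $V$ be a set of $n$ vertices and let $e_1,\ldots,e_{n-1}$ be a sequence of edges on $V$ that form a tree, arriving one at a time. With high probability in $n$, the Rank-Based Dancing-Walk Algorithm (defined in the context) can process all of $e_1,\ldots,e_{n-1}$ without declaring failure. If the algorithm does not declare failure, then each step (edge insertion) flips $O(\log\log n)$ edges and takes $O(\log n\log\log n)$ time. Additionally, no vertex's out-degree ever exceeds $3$.
   Context: Conventions. Logarithms are base 2; quantities such as $c\log\log n$, $d\log n$ are treated as integers. Running time is in the usual unit-cost RAM model. $c$ and $d$ are sufficiently large constants (parameters of the algorithm). ''With high probability in $n$'' means with probability at least $1-1/n^a$, where the constant $a>0$ can be made as large as desired by choosing the constants $c,d$ sufficiently large. The edge sequence is fixed independently of the algorithm's random bits. Problem (incremental edge orientation in a forest). After each arrival the algorithm must maintain an orientation of all edges inserted so far; these always form a forest on $V$. Flipping an edge means reversing its direction. Combination rank. A tree of size $1$ has combination rank $R(T)=0$. When trees $T_1,T_2$ of the current (undirected) forest are combined by an edge insertion into $T_3$, set $R(T_3)=\max(R(T_1),R(T_2))$ if $R(T_1)\ne R(T_2)$, and $R(T_3)=R(T_1)+1$ if $R(T_1)=R(T_2)$. The Rank-Based Dancing-Walk Algorithm. Each vertex has at most two primary out-going edges and at most one secondary out-going edge. When $e_t=\{v_1,v_2\}$ arrives, let $T_1\ni v_1$, $T_2\ni v_2$ be the two trees of the current forest joined by $e_t$, with names chosen so that $R(T_1)\le R(T_2)$ (ties broken arbitrarily, independently of the random bits). The combination ranks are maintained by a data structure of leaf-to-root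 pointer trees in which comparing ranks and merging takes $O(1+\min(R(T_1),R(T_2)))$ time. The algorithm performs a random walk starting at $v_1$ along primary directed edges. If the walk is at a vertex of out-degree less than $2$ (possibly $v_1$ itself), it terminates successfully there. Otherwise it moves along a uniformly random one of the two primary out-going edges of the current vertex. If it has not terminated earlier, it stops after $c\log\log n$ moves at a vertex $u$; if $u$ has out-degree less than $3$ the walk succeeds (when $u$ has out-degree exactly $2$, $u$ is said to volunteer, taking on a secondary out-going edge), while if $u$ has out-degree $3$ the walk fails. Failed walks are restarted from scratch with fresh randomness, up to $d\log n$ attempts in total; if all fail, the algorithm declares failure and stops. After a successful walk ending at $u$, all edges of the walk from $v_1$ to $u$ are flipped, and $e_t$ is oriented out of $v_1$. An edge newly out-going from a vertex $w$ is primary, replacing a lost primary edge or filling a free primary place, except that the new out-going edge of a volunteering vertex is its secondary edge. *)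

(* Defs.v *)
From mathcomp Require Import all_boot all_order all_algebra.
From mathcomp Require Import reals exp.

Set Implicit Arguments.
Unset Strict Implicit.
Unset Printing Implicit Defensive.

Import Order.TTheory GRing.Theory Num.Theory.

Section Forest.
Variable V : finType.

(* [e t] is the edge arriving at step [t] (steps are numbered from 0). A pair
   (x, y) stands for the unordered edge {x, y}. Only the first #|V|.-1 values
   of [e] are ever used. *)
Implicit Type e : nat -> V * V.

Definition forest e (t : nat) : rel V :=
  [rel x y | [exists i : 'I_t, (e i == (x, y)) || (e i == (y, x))]].

Definition forms_tree e : Prop :=
  let m := #|V|.-1 in
  [/\ forall i, i < m -> (e i).1 != (e i).2,
      forall i j, i < j < m -> e i != e j /\ e i != ((e j).2, (e j).1),
      forall x y, connect (forest e m) x y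
    & forall p : seq V, ucycle (forest e m) p -> size p <= 2].

(* [crank e t v] is the combination rank of the tree containing [v] in the
   forest formed by the first [t] edges. *)
Fixpoint crank e (t : nat) (v : V) : nat :=
  if t is s.+1 then
    let: (x, y) := e s in
    if connect (forest e s) x v || connect (forest e s) y v then
      let r1 := crank e s x in
      let r2 := crank e s y in
      if r1 == r2 then r1.+1 else maxn r1 r2
    else crank e s v
  else 0.

(* The pair (v1, v2) of step [t]; [tie t] breaks ties between equal ranks. *)
Definition endpoints e (tie : nat -> bool) (t : nat) : V * V :=
  let: (x, y) := e t in
  let r1 := crank e t x in
  let r2 := crank e t y in
  if (r1 < r2) || ((r1 == r2) && tie t) then (x, y) else (y, x).

(* The current orientation is the set [arcs] of pairs (tail, head); [sec] is
   the set of those arcs that are secondary. Neither the type nor the algorithm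
   caps the number of arcs leaving a vertex. *)
Record state := State { arcs : {set V * V}; sec : {set V * V} }.

Definition init : state := State set0 set0.

Definition outdeg (S : state) (v : V) : nat := #|[set w | (v, w) \in arcs S]|.

Definition primary (S : state) (v : V) : seq V :=
  enum [set w | (v, w) \in arcs S :\: sec S].

(* The walk consumes one random bit per move, hence makes at most [size bits]
   moves; it returns the list of vertices visited after [v]. The default value
   of [nth] is irrelevant: in every reachable state a vertex of out-degree at
   least 2 has exactly two primary arcs. *)
Fixpoint walk (S : state) (v : V) (bits : seq bool) : seq V :=
  if outdeg S v < 2 then [::] else
  if bits is b :: bits' then
    let w := nth v (primary S v) (nat_of_bool b) in w :: walk S w bits'
  else [::].

(* A walk that terminated early ends at out-degree less than 2, so a single
   test covers both kinds of success. *)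
Definition success (S : state) (v : V) (p : seq V) : bool :=
  outdeg S (last v p) < 3.

Definition walks (S : state) (v : V) (coins : seq (seq bool)) : seq (seq V) :=
  [seq walk S v bits | bits <- coins].

(* The attempts actually made: up to and including the first success. *)
Definition attempts (S : state) (v : V) (coins : seq (seq bool)) :
    seq (seq V) :=
  let ws := walks S v coins in take (find (success S v) ws).+1 ws.

(* [last (v1, v2) new] is the new arc leaving the final vertex of the walk,
   which is (v1, v2) itself when the walk makes no move. *)
Definition reroute (S : state) (v1 v2 : V) (p : seq V) : state :=
  let old := zip (v1 :: p) p in
  let new := [seq (a.2, a.1) | a <- old] in
  State ((v1, v2) |: ((arcs S :\: [set a in old]) :|: [set a in new]))
        (if outdeg S (last v1 p) == 2 then last (v1, v2) new |: sec S
         else sec S).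

(* [None] means that the algorithm declares failure. *)
Definition step e (tie : nat -> bool) (t : nat) (coins : seq (seq bool))
    (S : state) : option state :=
  let: (v1, v2) := endpoints e tie t in
  omap (reroute S v1 v2) (ohead (filter (success S v1) (walks S v1 coins))).

(* The state after the first [t] insertions; [coins t] lists, for each attempt
   of step [t], the random bits available to it. *)
Fixpoint run e (tie : nat -> bool) (coins : nat -> seq (seq bool)) (t : nat) :
    option state :=
  if t is s.+1 then obind (step e tie s (coins s)) (run e tie coins s)
  else Some init.

Definition flips (S S' : state) : nat :=
  #|[set a in arcs S | (a.2, a.1) \in arcs S']|.

End Forest.

(* Unit-cost RAM accounting: a constant for each primitive. [rank_cost] is the
   constant hidden in the O(1 + min(R(T1), R(T2))) bound for comparing and
   merging ranks; [move_cost] includes drawing the random bit. *)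
Record cost_model := CostModel {
  rank_cost : nat;
  attempt_cost : nat;
  move_cost : nat;
  flip_cost : nat;
  insert_cost : nat }.

Definition rank_time_ok (k : cost_model) (V : finType) (e : nat -> V * V)
    (rank_time : nat -> nat) : Prop :=
  forall t, t < #|V|.-1 ->
    rank_time t <=
      rank_cost k * (1 + minn (crank e t (e t).1) (crank e t (e t).2)).

(* Time of step [t], which leads from [S] to [S'], when the rank data structure
   spends [rank_time t] in that step. *)
Definition step_time (k : cost_model) (V : finType) (e : nat -> V * V)
    (tie : nat -> bool) (rank_time : nat -> nat) (t : nat)
    (coins : seq (seq bool)) (S S' : state V) : nat :=
  rank_time t
  + \sum_(p <- attempts S (endpoints e tie t).1 coins)
      (attempt_cost k + move_cost k * size p)
  + flip_cost k * flips S S' + insert_cost k.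

Local Open Scope ring_scope.

Section Probability.
Variable R : realType.

Definition log2 (x : R) : R := ln x / ln 2%:R.

Definition max_moves (c : R) (n : nat) : nat :=
  `|Num.ceil (c * log2 (log2 n%:R))|%N.

Definition max_attempts (d : R) (n : nat) : nat :=
  `|Num.ceil (d * log2 n%:R)|%N.

(* One independent fair bit for each step, attempt and move. *)
Definition sample (c d : R) (n : nat) : finType :=
  (n.-1).-tuple ((max_attempts d n).-tuple ((max_moves c n).-tuple bool)).

Definition coins (c d : R) (n : nat) (omega : sample c d n) (t : nat) :
    seq (seq bool) :=
  nth [::] [seq [seq tval bits | bits <- tval s] | s <- tval omega] t.

Definition Pr (Omega : finType) (A : {set Omega}) : R :=
  #|A|%:R / #|Omega|%:R.

End Probability.

(* Main.v *)
Require Import Defs.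
From mathcomp Require Import all_boot all_order all_algebra.
From mathcomp Require Import reals exp boolp zify ring lra.

Set Implicit Arguments.
Unset Strict Implicit.
Unset Printing Implicit Defensive.

Import Order.TTheory GRing.Theory Num.Theory.

(** A vertex [w] lies in the lower-rank tree of an insertion at most [log n]
    times, because each time its combination rank increases. In such a step it
    can acquire only one new out-neighbour, namely its neighbour towards the
    start [low s] of the walk, and this depends on the edge sequence alone. So
    all out-arcs ever present belong to a digraph of out-degree at most [log n]
    that is fixed in advance, and only [(log n) ^ O(2 ^ j)] trees of height [j]
    in it can be the tree of all walks of [j] moves from a given vertex. In a
    forest distinct walks from a vertex end at distinct vertices. Hence, as long
    as at least half of the walks succeed, every step makes a given vertex
    volunteer with probability at most [2 / 2 ^ j]. Therefore the product over
    the leaves of a fixed tree of suitable vertex weights, which are large for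
    volunteers, is a supermartingale, and it would have to be huge at the first
    step at which half of the walks fail. For [2 ^ j] a large power of [log n]
    this beats the union bound over all trees. *)

(** * Paths in a forest *)

Section Backtracking.
Variables (V : finType) (r : rel V).

Fixpoint nonback (l : seq V) : bool :=
  if l is x :: ((y :: l'') as l') then
    (if l'' is z :: _ then x != z else true) && nonback l'
  else true.

Lemma nonback_tail x l : nonback (x :: l) -> nonback l.
Proof. by case: l => // y l /= /andP[]. Qed.

(** The condition only concerns windows of three consecutive entries, and an overlap of two entries
    puts every window inside one of the two parts. *)
Lemma nonback_cat l1 x y l2 :
  nonback (l1 ++ [:: x, y & l2]) =
  nonback (l1 ++ [:: x; y]) && nonback [:: x, y & l2].
Proof.
elim: l1 => [//|a l1 IH]; rewrite !cat_cons.
case: l1 IH => [|b l1] /= IH; first by rewrite !andbT.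
by rewrite IH; case: l1 {IH} => [|c l1] /=; rewrite !andbA.
Qed.

Lemma nonback_rev l : nonback (rev l) = nonback l.
Proof.
elim: l => [//|x [//|y [//|z l]] IH].
have -> : rev [:: x, y, z & l] = rev l ++ [:: z, y & [:: x]].
  by rewrite !rev_cons -!cats1 -!catA.
rewrite nonback_cat.
have -> : rev l ++ [:: z; y] = rev [:: y, z & l].
  by rewrite !rev_cons -!cats1 -!catA.
by rewrite IH /= andbT andbC eq_sym.
Qed.

Lemma uniq_nonback l : uniq l -> nonback l.
Proof.
elim: l => [//|x l IH] /= /andP[xl ul]; move/IH: ul.
case: l xl {IH} => [//|y [//|z l]] + ->; rewrite andbT !inE !negb_or.
by case/and3P.
Qed.

Hypothesis r_irr : forall x, ~~ r x x.
Hypothesis r_sym : symmetric r.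
Hypothesis r_acyc : forall p, ucycle r p -> size p <= 2.

(** The stretch up to the first return to the head would be a cycle. Acyclicity leaves lengths 1 and
    2: the former is a loop, the latter an immediate turn back. *)
Lemma nonback_path_uniq l : sorted r l -> nonback l -> uniq l.
Proof.
elim: l => [//|x l IH] sl nl.
have ul : uniq l by apply: IH; [exact: path_sorted sl | exact: nonback_tail nl].
rewrite cons_uniq ul andbT; apply/negP => xl.
case/splitPr: xl sl nl ul => p1 p2 sl nl ul.
move: (sl); rewrite /= cat_path /= => /and3P[sp1 rx _].
have /r_acyc : ucycle r (x :: p1).
  apply/andP; split; first by rewrite /= rcons_path sp1.
  by move: ul; rewrite cat_uniq /= negb_or => /and3P[-> /andP[-> _] _].
case: p1 sp1 rx nl {sl ul} => [|y [|z p1]] //= _ rx.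
- by rewrite (negPf (r_irr _)) in rx.
- by rewrite eqxx.
Qed.

(** Reversing the first path and continuing with the second gives a path through [v] that does not
    turn back there because [a != b]. It is therefore simple, so its two ends differ. *)
Lemma diverging_paths_last v a b p q : a != b ->
  path r v (a :: p) -> nonback [:: v, a & p] ->
  path r v (b :: q) -> nonback [:: v, b & q] ->
  last a p != last b q.
Proof.
move=> ab pp np pq nq; apply/eqP => lpq.
have E : rev (a :: p) ++ [:: v, b & q] = rev p ++ [:: a, v & b :: q].
  by rewrite rev_cons -cats1 -catA.
have /nonback_path_uniq : sorted r (rev (a :: p) ++ [:: v, b & q]).
  rewrite E -cat_rcons sorted_cat_cons -rev_cons.
  apply/andP; split; last exact: pq.
  have -> : rcons (rev (a :: p)) v = rev [:: v, a & p] by rewrite -rev_cons.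
  by rewrite rev_sorted; rewrite (eq_sorted (e' := r)) // => x y; rewrite r_sym.
rewrite {1}E nonback_cat.
have -> : rev p ++ [:: a; v] = rev [:: v, a & p] by rewrite !rev_cons -!cats1 -!catA.
rewrite nonback_rev np /= ab; move: nq => /= -> /(_ isT).
have -> : rev (a :: p) = last a p :: behead (rev (a :: p)).
  by case: (lastP p) => [//|s x]; rewrite last_rcons -rcons_cons rev_rcons.
by rewrite /= mem_cat inE lpq mem_last !orbT.
Qed.

Definition toward (z w y : V) :=
  exists q, [/\ path r w (y :: q), uniq [:: w, y & q] & last y q = z].

Lemma toward_unique z w y y' : toward z w y -> toward z w y' -> y = y'.
Proof.
case=> q [pq uq lq] [q' [pq' uq' lq']]; apply/eqP; apply/negPn/negP => ne.
have := diverging_paths_last ne pq (uniq_nonback uq) pq' (uniq_nonback uq').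
by rewrite lq lq' eqxx.
Qed.

End Backtracking.

(** * Combination ranks *)

Section Trees.
Variables (V : finType) (e : nat -> V * V) (tie : nat -> bool).

Lemma forest_sym t : symmetric (forest e t).
Proof. by move=> x y; apply/existsP/existsP => -[i]; rewrite orbC; exists i. Qed.

Lemma forest_connect_sym t : connect_sym (forest e t).
Proof. exact: sym_connect_sym (@forest_sym t). Qed.

Lemma forest_sub s t : s <= t -> subrel (forest e s) (forest e t).
Proof.
by move=> st x y /existsP[i Hi]; apply/existsP; exists (widen_ord st i).
Qed.

Lemma forestS s x y :
  forest e s.+1 x y = [|| forest e s x y, e s == (x, y) | e s == (y, x)].
Proof.
apply/existsP/idP => [[i]|].
  case: (ltngtP i s) => [lt_is|gt_is|->] Hi.
  - by apply/orP; left; apply/existsP; exists (Ordinal lt_is).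
  - by have := ltn_ord i; rewrite ltnS leqNgt gt_is.
  - by rewrite Hi orbT.
case/orP => [/existsP[i Hi]|Hs]; last by exists ord_max.
by exists (widen_ord (leqnSn s) i).
Qed.

Lemma connect_invariant (r : rel V) (T : Type) (f : V -> T) :
  (forall x y, r x y -> f x = f y) -> forall x y, connect r x y -> f x = f y.
Proof.
move=> rf x y /connectP[p + ->]; elim: p x => [//|z p IH] x /= /andP[/rf -> /IH].
by [].
Qed.

Lemma crankS s v :
  crank e s.+1 v =
  if connect (forest e s) (e s).1 v || connect (forest e s) (e s).2 v then
    if crank e s (e s).1 == crank e s (e s).2 then (crank e s (e s).1).+1
    else maxn (crank e s (e s).1) (crank e s (e s).2)
  else crank e s v.
Proof. by rewrite /=; case: (e s). Qed.

Lemma crank_connect s x y :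
  connect (forest e s) x y -> crank e s x = crank e s y.
Proof.
elim: s x y => [//|s IH]; apply: connect_invariant => x y.
have touch z : connect (forest e s) x y ->
    connect (forest e s) z x = connect (forest e s) z y.
  by move=> xy; apply: (same_connect_r (@forest_connect_sym s)).
rewrite forestS !crankS => /orP[/connect1 xy|].
  by rewrite (touch (e s).1 xy) (touch (e s).2 xy) (IH _ _ xy).
by case/orP => /eqP -> /=; rewrite !connect0 /= ?orbT.
Qed.

Lemma crank_mono s v : crank e s v <= crank e s.+1 v.
Proof.
rewrite crankS; case: ifP => // /orP[] /crank_connect <-; case: eqVneq => // E;
  by rewrite ?E ?leq_maxl ?leq_maxr.
Qed.

Lemma endpoints_cases s :
  (endpoints e tie s = e s /\ crank e s (e s).1 <= crank e s (e s).2) \/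
  (endpoints e tie s = ((e s).2, (e s).1) /\
   crank e s (e s).2 <= crank e s (e s).1).
Proof.
rewrite /endpoints; case: (e s) => x y /=.
by case: (ltngtP (crank e s x) (crank e s y)) => H /=; rewrite ?H ?leqnn;
   case: (tie s) => /=; [left|left|right|right|left|right].
Qed.

Definition low s := (endpoints e tie s).1.
Definition high s := (endpoints e tie s).2.

Definition in_low s w := connect (forest e s) (low s) w.

(** The lower tree either takes over a strictly larger rank or takes part in a tie, which increments
    the rank. *)
Lemma crank_in_low s w : in_low s w -> crank e s w < crank e s.+1 w.
Proof.
rewrite /in_low /low crankS => lw; move: (crank_connect lw).
case: (endpoints_cases s) => -[E le]; rewrite E /= in lw *; rewrite lw ?orbT => <-;
 by case: (ltngtP (crank e s (e s).1) (crank e s (e s).2)) le => //=; lia.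
Qed.

Definition low_count s d w := count (in_low^~ w) (iota s d).

Lemma low_count_crank s d w : low_count s d w + crank e s w <= crank e (s + d) w.
Proof.
elim: d s => [|d IH] s; first by rewrite addn0.
rewrite addnS -addSn /low_count /=; apply: leq_trans (IH s.+1).
rewrite addnAC addnC leq_add2l; case E: (in_low s w); first exact: crank_in_low.
exact: crank_mono.
Qed.

Hypothesis tree : forms_tree e.

Let m := #|V|.-1.
Notation final := (forest e m).

Lemma final_irr x : ~~ final x x.
Proof.
case: tree => irr _ _ _; apply/existsP => -[i]; rewrite orbb => /eqP E.
by have := irr i (ltn_ord i); rewrite E eqxx.
Qed.

Lemma final_acyclic p : ucycle final p -> size p <= 2.
Proof. by case: tree => _ _ _; apply. Qed.

(** A simple path between the endpoints would close up with the new edge to a cycle of the final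
    tree. Such a cycle is so short that the path is empty or a single edge, making [e s] a loop or a
    repetition. *)
Lemma new_edge_disconnected s : s < m -> ~~ connect (forest e s) (e s).1 (e s).2.
Proof.
move=> sm; apply/connectP => -[p0 p0P]; case/shortenP: p0P => p pP up _ {p0} lp.
case: tree => irr dist _ acyc.
have fs : final (last (e s).1 p) (e s).1.
  apply: (forest_sub sm); rewrite forestS -lp.
  by case: (e s) => a b /=; rewrite eqxx !orbT.
have /acyc : ucycle final ((e s).1 :: p).
  apply/andP; split=> //=; rewrite rcons_path fs andbT.
  by apply: sub_path pP; apply: forest_sub; apply: ltnW.
case: p pP lp {up fs} => [|y [|//]] /=; 
  first by move=> _ E; have := irr s sm; rewrite E eqxx.
rewrite andbT => /existsP[i Hi] E _; have [] := dist i s; first by rewrite ltn_ord.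
by case/orP: Hi => /eqP ->; rewrite -E ?eqxx //; case: (e s) => ? ?; rewrite eqxx.
Qed.

(** The rank grows beyond the larger one only at a tie, where two disjoint trees, each of size at
    least [2 ^ r], are merged. *)
Lemma crank_card s v : s <= m ->
  2 ^ crank e s v <= #|[set y | connect (forest e s) v y]|.
Proof.
elim: s v => [|s IH] v sm.
  by rewrite expn0 card_gt0; apply/set0Pn; exists v; rewrite inE connect0.
have sub x : connect (forest e s.+1) v x ->
    [set y | connect (forest e s) x y] \subset [set y | connect (forest e s.+1) v y].
  move=> vx; apply/subsetP => y; rewrite !inE => xy; apply: connect_trans vx _.
  by apply: connect_sub xy => a b ab; apply: connect1; apply: forest_sub ab.
have ab : connect (forest e s.+1) (e s).1 (e s).2.
  by apply: connect1; rewrite forestS; case: (e s) => a b; rewrite eqxx orbT.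
have ba : connect (forest e s.+1) (e s).2 (e s).1 by rewrite forest_connect_sym.
rewrite crankS; case: ifP => H; last first.
  by apply: leq_trans (IH v (ltnW sm)) (subset_leq_card _); apply: sub; apply: connect0.
set A := [set y | connect (forest e s) (e s).1 y].
set B := [set y | connect (forest e s) (e s).2 y].
have up x y : connect (forest e s) x y -> connect (forest e s.+1) y x.
  rewrite forest_connect_sym.
  by apply: connect_sub => a b ab1; apply: connect1; apply: forest_sub ab1.
have [va vb] : connect (forest e s.+1) v (e s).1 /\ connect (forest e s.+1) v (e s).2.
  by case/orP: H => /up vx; split=> //; apply: connect_trans vx _.
have dAB : [disjoint A & B].
  apply/pred0P => y; apply/negP; rewrite /= !inE => /andP[ay yb].
  have := new_edge_disconnected sm; rewrite (connect_trans ay) //.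
  by rewrite forest_connect_sym.
have le : #|A| + #|B| <= #|[set y | connect (forest e s.+1) v y]|.
  rewrite -[X in X <= _]subn0 -(cards0 V) -(disjoint_setI0 dAB) -cardsU.
  by apply: subset_leq_card; rewrite subUset !sub.
have hA := IH (e s).1 (ltnW sm); have hB := IH (e s).2 (ltnW sm).
apply: leq_trans le; case: eqVneq => [E|_].
  by rewrite expnS mul2n -addnn {2}E leq_add.
by rewrite /maxn; case: ifP => _;
  [apply: leq_trans hB (leq_addl _ _) | apply: leq_trans hA (leq_addr _ _)].
Qed.

Lemma crank_le s v : s <= m -> crank e s v <= trunc_log 2 #|V|.
Proof.
by move=> sm; apply: trunc_log_max => //; apply: leq_trans (crank_card v sm) (max_card _).
Qed.

Lemma low_count_le w : low_count 0 m w <= trunc_log 2 #|V|.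
Proof.
by have := low_count_crank 0 m w; rewrite addn0 => /leq_trans->//; apply: crank_le.
Qed.

End Trees.

(** * Orientations *)

Section Arcs.
Variable V : finType.
Implicit Types (S : state V) (v w : V) (p : seq V).

Lemma outdeg_init v : outdeg (@init V) v = 0.
Proof.
by rewrite /outdeg -[RHS](cards0 V); apply: eq_card => y; rewrite !inE.
Qed.

Definition arc_rel S : rel V := fun x y => (x, y) \in arcs S.
Definition primary_arc S : rel V := fun x y => (x, y) \in arcs S :\: sec S.

Lemma primary_arcW S : subrel (primary_arc S) (arc_rel S).
Proof. by move=> x y; rewrite /primary_arc inE => /andP[]. Qed.

Lemma size_walk S v bits : size (walk S v bits) <= size bits.
Proof.
by elim: bits v => [|b bits IH] v /=; case: ifP => //= _; rewrite ltnS IH.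
Qed.

Lemma card_heads (s : seq (V * V)) w : uniq (unzip1 s) ->
  #|[set y | (w, y) \in s]| = (w \in unzip1 s).
Proof.
elim: s => [_|[a b] s IH] /=.
  by rewrite -[RHS](cards0 V); apply: eq_card => y; rewrite !inE.
case/andP=> as_ us; rewrite inE; case: eqVneq => [->|wa] /=; last first.
  by rewrite -IH //; apply: eq_card => y; rewrite !inE xpair_eqE (negPf wa).
rewrite -[RHS](cards1 b); apply: eq_card => y; rewrite !inE xpair_eqE eqxx /=.
case: eqVneq => //= _; apply/negbTE; apply: contra as_ => /(map_f fst).
exact.
Qed.

Lemma unzip1_zip_belast v p : unzip1 (zip (v :: p) p) = belast v p.
Proof. by elim: p v => [//|a p IH] v /=; rewrite -IH. Qed.

Definition rev_arcs v p := [seq (a.2, a.1) | a <- zip (v :: p) p].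

Lemma unzip1_rev_arcs v p : unzip1 (rev_arcs v p) = p.
Proof. by rewrite /rev_arcs /unzip1 -map_comp; apply: unzip2_zip => /=. Qed.

Lemma mem_rev_arcs v p x y : ((x, y) \in rev_arcs v p) = ((y, x) \in zip (v :: p) p).
Proof.
apply/mapP/idP => [[[a b] H [-> ->]] //|H]; by exists (y, x).
Qed.

Lemma zip_path (r : rel V) v p x y :
  path r v p -> (x, y) \in zip (v :: p) p -> r x y.
Proof.
elim: p v => [//|a p IH] v /= /andP[va pp].
by rewrite inE xpair_eqE => /orP[/andP[/eqP-> /eqP->]//|]; apply: IH.
Qed.

Lemma zip_split v p x y : (y, x) \in zip (v :: p) p ->
  exists p1 p2, p = p1 ++ x :: p2 /\ y = last v p1.
Proof.
elim: p v => [//|a p IH] v /=; rewrite inE xpair_eqE => /orP[/andP[/eqP-> /eqP->]|].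
  by exists [::], p.
by case/IH => p1 [p2 [-> ->]]; exists (a :: p1), p2.
Qed.

(** Stated between numbers for counting arcs: [v :: p] lists the vertices that gain an out-arc by a
    reroute, and [belast v p] those that lose one. *)
Lemma mem_belast_last v p w : uniq (v :: p) ->
  (w \in v :: p) = (w \in belast v p) + (w == last v p) :> nat.
Proof.
rewrite lastI rcons_uniq mem_rcons inE => /andP[nl _].
by case: eqVneq => [->|_] /=; rewrite ?(negPf nl) // addn0.
Qed.

End Arcs.

(** * Invariants of reachable orientations *)

Section Invariant.
Variables (V : finType) (e : nat -> V * V) (tie : nat -> bool).
Hypothesis tree : forms_tree e.

Let m := #|V|.-1.
Notation final := (forest e m).
Notation low := (low e tie).
Notation high := (high e tie).
Notation in_low := (in_low e tie).

(** The direction is read off the final tree, so that it depends on the edge sequence alone. The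
    default [w] is never returned: in a tree every [w] other than [low s] has a simple path to
    it. *)
Definition new_head s w : V :=
  if w == low s then high s
  else odflt w [pick y | `[< toward final (low s) w y >]].

(* Every out-neighbour that [w] ever acquires is fixed by the edge sequence:
   it is the neighbour of [w] in the direction from which the walk came. *)
Definition cand w : seq V := [seq new_head s w | s <- iota 0 m & in_low s w].

Lemma size_cand w : size (cand w) <= trunc_log 2 #|V|.
Proof. by rewrite size_map size_filter; apply: (low_count_le tie tree). Qed.

(** By [wf_secout] a vertex of out-degree 2 or 3 has exactly two primary arcs, so that both bits of
    a move are meaningful. [wf_cand] confines the orientation to the digraph fixed in advance. *)
Record wf_state (s : nat) (S : state V) : Prop := WfState {
  wf_forest : forall x y, forest e s x y = arc_rel S x y || arc_rel S y x;
  wf_anti : forall x y, arc_rel S x y -> ~~ arc_rel S y x;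
  wf_sec : sec S \subset arcs S;
  wf_out : forall v, outdeg S v <= 3;
  wf_secout : forall v, #|[set w | (v, w) \in sec S]| = (outdeg S v == 3);
  wf_cand : forall v w, arc_rel S v w -> w \in cand v }.

Lemma wf_init : wf_state 0 (@init V).
Proof.
split=> [x y|x y|||v|v w]; rewrite /arc_rel ?inE ?outdeg_init //.
- by apply/existsP => -[[]].
- by move=> v; rewrite outdeg_init.
- by rewrite -[RHS](cards0 V); apply: eq_card => y; rewrite !inE.
Qed.

Section State.
Variables (s : nat) (S : state V).
Hypotheses (sm : s <= m) (I : wf_state s S).

Lemma arc_path_nonback v p : path (arc_rel S) v p -> nonback (v :: p).
Proof.
elim: p v => [//|a p IH] v /= /andP[va pp]; move: (IH a pp) => /= ->; rewrite andbT.
case: p pp {IH} => [//|b p] /= /andP[ab _].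
by apply/negP => /eqP vb; move: (wf_anti I va); rewrite vb ab.
Qed.

Lemma arc_forest : subrel (arc_rel S) (forest e s).
Proof. by move=> x y xy; rewrite (wf_forest I) xy. Qed.

Lemma arc_final : subrel (arc_rel S) final.
Proof. by move=> x y /arc_forest; apply: forest_sub. Qed.

Lemma arc_path_uniq v p : path (arc_rel S) v p -> uniq (v :: p).
Proof.
move=> pp; apply: (nonback_path_uniq (final_irr tree) (final_acyclic tree)).
  exact: sub_path arc_final _ _ pp.
exact: arc_path_nonback.
Qed.

Lemma arc_path_last v a b p q : a != b ->
  path (arc_rel S) v (a :: p) -> path (arc_rel S) v (b :: q) -> last a p != last b q.
Proof.
move=> ab pp pq.
apply: (diverging_paths_last (final_irr tree) (@forest_sym V e m) (final_acyclic tree) ab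
         (v := v)); try exact: arc_path_nonback.
  exact: sub_path arc_final _ _ pp.
exact: sub_path arc_final _ _ pq.
Qed.

Lemma size_primary v : 1 < outdeg S v -> size (primary S v) = 2.
Proof.
move=> o2; rewrite /primary -cardE.
have -> : [set w | (v, w) \in arcs S :\: sec S] =
          [set w | (v, w) \in arcs S] :\: [set w | (v, w) \in sec S].
  by apply/setP => w; rewrite !inE.
rewrite cardsD (setIidPr _); last first.
  by apply/subsetP => w; rewrite !inE; apply: (subsetP (wf_sec I)).
rewrite (wf_secout I) -/(outdeg S v).
by have := wf_out I v; move: o2; case: (outdeg S v) => [|[|[|[|]]]].
Qed.

Lemma primary_nth v (b : bool) : 1 < outdeg S v ->
  primary_arc S v (nth v (primary S v) b).
Proof.
move=> o2; have : nth v (primary S v) b \in primary S v.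
  by apply: mem_nth; rewrite size_primary //; case: b.
by rewrite mem_enum inE.
Qed.

Lemma primary_nth_neq v : 1 < outdeg S v ->
  nth v (primary S v) 0 != nth v (primary S v) 1.
Proof. by move=> o2; rewrite nth_uniq ?size_primary ?enum_uniq. Qed.

Lemma walk_path v bits : path (primary_arc S) v (walk S v bits).
Proof.
elim: bits v => [|b bits IH] v /=; case: ltnP => //= o2.
by rewrite IH andbT primary_nth.
Qed.

End State.

(** * Effect of one insertion on the orientation *)

Section Reroute.
Variables (s : nat) (S : state V).
Hypotheses (sm : s < m) (I : wf_state s S).
Variable p : seq V.
Hypothesis pp : path (primary_arc S) (low s) p.
Let u := last (low s) p.
Hypothesis fit : outdeg S u < 3.
Let S' := reroute S (low s) (high s) p.
Let old := zip (low s :: p) p.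
Let new := (low s, high s) :: rev_arcs (low s) p.

Let pa : path (arc_rel S) (low s) p.
Proof. exact: sub_path (@primary_arcW _ S) _ _ pp. Qed.

Let up : uniq (low s :: p).
Proof. exact: arc_path_uniq (ltnW sm) I _ _ pa. Qed.

Let old_primary x y : (x, y) \in old -> primary_arc S x y.
Proof. exact: zip_path pp. Qed.

Let arcS' x y : arc_rel S' x y = ((x, y) \in new) || arc_rel S x y && ((x, y) \notin old).
Proof.
rewrite {1}/arc_rel /= in_setU1 in_setU in_setD !in_set -/(rev_arcs (low s) p) -/old
  /new in_cons /arc_rel.
by rewrite -orbA; congr (_ || _); rewrite orbC andbC.
Qed.

Lemma low_high_forest : ~~ forest e s (low s) (high s).
Proof.
apply/negP => /connect1; rewrite /low /high => lh.
have /negP := new_edge_disconnected tree sm; apply.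
by case: (endpoints_cases e tie s) lh => -[-> _] //=; rewrite forest_connect_sym.
Qed.

Let new_not_arc x y : (x, y) \in new -> ~~ arc_rel S x y.
Proof.
rewrite in_cons xpair_eqE mem_rev_arcs => /orP[/andP[/eqP-> /eqP->]|].
  by apply: contra low_high_forest; apply: arc_forest I _ _.
by move/old_primary/primary_arcW/(wf_anti I).
Qed.

(** Every vertex of the walk gains one out-arc, and every one but the last loses one. The walk is
    simple, so nothing is counted twice. *)
Lemma outdeg_reroute w : outdeg S' w = outdeg S w + (w == u).
Proof.
rewrite /outdeg.
have -> : [set y | (w, y) \in arcs S'] = [set y | (w, y) \in new] :|:
   ([set y | (w, y) \in arcs S] :\: [set y | (w, y) \in old]).
  apply/setP => y; transitivity (arc_rel S' w y); first by rewrite in_set.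
  by rewrite arcS' andbC in_setU in_setD !in_set.
have dj : [disjoint [set y | (w, y) \in new] &
    [set y | (w, y) \in arcs S] :\: [set y | (w, y) \in old]].
  apply/pred0P => y; rewrite /= !in_setD !in_set.
  case: (boolP (_ \in new)) => //= /new_not_arc/negPf.
  by rewrite /arc_rel => ->; rewrite andbF.
have sub : [set y | (w, y) \in old] \subset [set y | (w, y) \in arcs S].
  by apply/subsetP => y; rewrite !inE => /old_primary/primary_arcW.
rewrite cardsU (disjoint_setI0 dj) cards0 subn0 cardsD (setIidPr sub).
rewrite !card_heads; last first.
- by rewrite /new /= unzip1_rev_arcs.
- by rewrite /old unzip1_zip_belast; move: up; rewrite lastI rcons_uniq => /andP[].
have := subset_leq_card sub; rewrite card_heads; last first.
  by rewrite /old unzip1_zip_belast; move: up; rewrite lastI rcons_uniq => /andP[].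
rewrite /old unzip1_zip_belast /new /= unzip1_rev_arcs (mem_belast_last _ up) -/u.
by move=> H; rewrite addnAC subnKC.
Qed.

(** For a flipped arc, the reversed initial part of the walk is a simple path from [x] through [y]
    to [low s], and the neighbour in that direction is unique in a forest. *)
Lemma new_head_path x y : (x, y) \in new -> y = new_head s x /\ in_low s x.
Proof.
rewrite in_cons xpair_eqE mem_rev_arcs => /orP[/andP[/eqP-> /eqP->]|xy].
  by rewrite /new_head eqxx; split=> //; apply: connect0.
have [p1 [p2 [Ep Ey]]] := zip_split xy.
have cx : in_low s x.
  apply/connectP; exists (rcons p1 x); last by rewrite last_rcons.
  apply: sub_path (arc_forest I) _ _ _; move: pa.
  by rewrite Ep -cat_rcons cat_path => /andP[].
split=> //; have xl : x != low s.
  apply/negP => /eqP xl; move: up; rewrite Ep -xl /= mem_cat inE eqxx orbT //.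
have tw : toward final (low s) x y.
  have E : rev (low s :: p1) = y :: behead (rev (low s :: p1)).
    by rewrite Ey; case: (lastP p1) => [//|l z]; rewrite last_rcons -rcons_cons rev_rcons.
  exists (behead (rev (low s :: p1))); rewrite -E.
  have -> : x :: rev (low s :: p1) = rev (rcons (low s :: p1) x) by rewrite rev_rcons.
  split.
  - change (sorted final (x :: rev (low s :: p1))).
    have -> : x :: rev (low s :: p1) = rev (rcons (low s :: p1) x) by rewrite rev_rcons.
    rewrite rev_sorted (eq_sorted (e' := final)); last by move=> a b; rewrite forest_sym.
    apply: sub_path (arc_final (ltnW sm) I) _ _ _; move: pa.
    by rewrite Ep -cat_rcons cat_path => /andP[].
  - rewrite rev_uniq; move: up; rewrite Ep -cat_rcons -cat_cons cat_uniq rcons_cons.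
    by case/andP.
  - by rewrite -[last y _]/(last x (y :: _)) -E rev_cons last_rcons.
rewrite /new_head (negPf xl); case: pickP => [z /asboolP tz /=|/(_ y) /asboolP//].
exact: toward_unique (final_irr tree) (@forest_sym V e m) (final_acyclic tree) _ _ _ _ tw tz.
Qed.

Lemma wf_reroute : wf_state s.+1 S'.
Proof.
(* This is the new arc leaving the final vertex [u]; for an empty walk it is the inserted edge
   itself. *)
have lastn : last (low s, high s) (rev_arcs (low s) p) \in new by apply: mem_last.
have lastE : (last (low s, high s) (rev_arcs (low s) p)).1 = u.
  rewrite /u -[in RHS](unzip1_rev_arcs (low s) p).
  by rewrite -[low s in RHS]/((low s, high s).1) last_map.
split.
- move=> x y; rewrite forestS !arcS' (wf_forest I).
  have -> : (e s == (x, y)) || (e s == (y, x)) =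
      ((x, y) == (low s, high s)) || ((y, x) == (low s, high s)).
    rewrite ![_ == (low s, _)]eq_sym /low /high -surjective_pairing.
    by case: (endpoints_cases e tie s) => -[-> _] //; rewrite orbC; case: (e s) => a b /=;
       rewrite !xpair_eqE; congr orb; rewrite andbC.
  rewrite !in_cons !mem_rev_arcs -/old.
  have oa a b : (a, b) \in old -> arc_rel S a b by move/old_primary/primary_arcW.
  move: (oa x y) (oa y x).
  by do 2!case: (_ \in old); do 2!case: (arc_rel S _ _); do 2!case: (_ == (low s, high s));
    move=> //= h1 h2;
    first [by move: (h1 isT) | by move: (h2 isT)].
(* By [key], an old arc opposite to a new one lay on the walk and has been removed. Two opposite new
   arcs would both be the inserted edge, whose ends would then coincide. *)
- move=> x y; rewrite !arcS' negb_or negb_and negbK.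
  have key a b : (a, b) \in new -> arc_rel S b a -> (b, a) \in old.
    rewrite in_cons xpair_eqE mem_rev_arcs => /orP[/andP[/eqP-> /eqP->]|//].
    by move=> H; have := low_high_forest; rewrite (wf_forest I) H orbT.
  have anti a b : (a, b) \in old -> (a, b) \in new -> False.
    by move/old_primary/primary_arcW => H /new_not_arc; rewrite H.
  case/orP => [xy|/andP[xy nxy]].
    apply/andP; split; last first.
      by case: (boolP (arc_rel S y x)) => //= yx; apply: key xy yx.
    apply/negP => yx; have ha := new_not_arc xy; have hb := new_not_arc yx.
    have H a b : (a, b) \in new -> ~~ arc_rel S b a -> (a, b) = (low s, high s).
      rewrite in_cons => /orP[/eqP//|]; rewrite mem_rev_arcs => /old_primary/primary_arcW ->.
      by [].
    have [Ex Ey] := H _ _ xy hb; have [Ex' _] := H _ _ yx ha.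
    have /negP := new_edge_disconnected tree sm; apply.
    move: Ex'; rewrite Ey /high /low.
    by case: (endpoints_cases e tie s) => -[-> _] /= ->; apply: connect0.
  apply/andP; split; last by rewrite (negPf (wf_anti I xy)).
  by apply: contra nxy => yx; apply: key yx xy.
- apply/subsetP => -[x y] xy; rewrite -/(arc_rel S' x y) arcS'.
  (* The walk follows primary arcs only, so an old secondary arc is never flipped. *)
  suff : ((x, y) \in new) || ((x, y) \in sec S).
    case/orP => [-> //|ss]; have -> : arc_rel S x y by apply: (subsetP (wf_sec I)).
    rewrite /=; apply/orP; right; apply/negP => /old_primary.
    by rewrite /primary_arc inE ss.
  move: xy; rewrite /S' /reroute /=; case: ifP => _; last by move=> ->; rewrite orbT.
  by rewrite in_setU1 => /orP[/eqP ->|->]; rewrite ?lastn ?orbT.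
- move=> v; rewrite outdeg_reroute; case: eqVneq => [->|_]; first by rewrite addn1.
  by rewrite addn0; apply: wf_out I v.
- move=> v; rewrite outdeg_reroute /S' /reroute /= -/u -/(rev_arcs _ _).
  (* A volunteer reaches out-degree 3 together with its secondary arc; otherwise [u] had out-degree
     at most 1 and stays below 3. *)
  case: ifP => [/eqP o2|o2].
    set a := last _ _ in lastn lastE *.
    have na : a \notin sec S.
      case: (a) lastn => x y /new_not_arc; apply: contra; exact: (subsetP (wf_sec I)).
    case: (eqVneq v u) => [->|vu].
      have -> : [set w | (u, w) \in a |: sec S] = a.2 |: [set w | (u, w) \in sec S].
        apply/setP => w; rewrite !inE; congr orb; case: (a) lastE => x y /= ->.
        by rewrite xpair_eqE eqxx.
      rewrite cardsU1 (wf_secout I) o2 /= inE; case: (a) lastE na => x y /= -> ->.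
      by [].
    rewrite addn0 -(wf_secout I v); apply: eq_card => w; rewrite !inE.
    by case: (a) lastE => x y /= ->; rewrite xpair_eqE (negPf vu).
  rewrite (wf_secout I v); case: (eqVneq v u) => [->|_]; last by rewrite addn0.
  by move: fit o2; case: (outdeg S u) => [|[|[|]]].
- move=> v w; rewrite arcS' => /orP[/new_head_path[-> lv]|/andP[vw _]];
    last exact: wf_cand I _ _ vw.
  by apply: map_f; rewrite mem_filter lv mem_iota /= add0n.
Qed.

(** An arc whose reverse is present afterwards lay on the walk: old arcs never come in opposite
    pairs, and the inserted edge is not yet in the forest. *)
Lemma flips_reroute : flips S S' <= size p.
Proof.
have -> : size p = size old by rewrite /old size_zip /= (minn_idPr (leqnSn _)).
apply: leq_trans (card_size old); apply: subset_leq_card; apply/subsetP => -[x y].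
rewrite inE -/(arc_rel S x y) /= -/(arc_rel S' y x) arcS' => /andP[xy].
rewrite (negPf (wf_anti I xy)) orbF in_cons xpair_eqE mem_rev_arcs.
case/orP => [/andP[/eqP E1 /eqP E2]|//].
by have := low_high_forest; rewrite (wf_forest I) -E1 -E2 xy orbT.
Qed.

End Reroute.
End Invariant.

Local Open Scope ring_scope.

(** * Random walks *)

Section Mean.
Variable R : realFieldType.

Definition mean (T : finType) (f : T -> R) : R := (\sum_x f x) / #|T|%:R.

Lemma eq_mean (T : finType) (f g : T -> R) : f =1 g -> mean f = mean g.
Proof. by move=> fg; rewrite /mean (eq_bigr g). Qed.

Lemma le_mean (T : finType) (f g : T -> R) :
  (forall x, f x <= g x) -> mean f <= mean g.
Proof. by move=> fg; rewrite ler_wpM2r ?invr_ge0 ?ler0n // ler_sum. Qed.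

Lemma mean_ge0 (T : finType) (f : T -> R) : (forall x, 0 <= f x) -> 0 <= mean f.
Proof. by move=> f0; rewrite mulr_ge0 ?invr_ge0 ?ler0n // sumr_ge0. Qed.

Lemma meanD (T : finType) (f g : T -> R) :
  mean (fun x => f x + g x) = mean f + mean g.
Proof. by rewrite /mean big_split mulrDl. Qed.

Lemma meanZ (T : finType) (a : R) (f : T -> R) :
  mean (fun x => a * f x) = a * mean f.
Proof. by rewrite /mean -mulr_sumr mulrA. Qed.

Lemma mean_sum (T : finType) I (r : seq I) (P : pred I) (f : I -> T -> R) :
  mean (fun x => \sum_(i <- r | P i) f i x) = \sum_(i <- r | P i) mean (f i).
Proof. by rewrite /mean exchange_big /= mulr_suml. Qed.

Lemma mean_cst (T : finType) (a : R) : (0 < #|T|)%N -> mean (fun _ : T => a) = a.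
Proof. by move=> T0; rewrite /mean sumr_const -[a *+ _]mulr_natr mulfK // pnatr_eq0 -lt0n. Qed.

Lemma mean_tuple0 (T : finType) (f : seq T -> R) :
  mean (fun t : 0.-tuple T => f t) = f [::].
Proof.
rewrite /mean card_tuple expn0 divr1 (eq_bigr (fun=> f [::])).
  by rewrite sumr_const card_tuple expn0.
by move=> t _; rewrite tuple0.
Qed.

(** Independence in the form of iterated averaging: the first coordinate outside, all later ones
    inside. *)
Lemma mean_tupleS (T : finType) n (f : seq T -> R) :
  mean (fun t : n.+1.-tuple T => f t) =
  mean (fun x : T => mean (fun t : n.-tuple T => f (x :: t))).
Proof.
rewrite /mean -mulr_suml -mulrA -invfM -natrM !card_tuple -expnSr; congr (_ / _).
rewrite (pair_big xpredT xpredT (fun (x : T) (t : n.-tuple T) => f (x :: t))) /=.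
rewrite (reindex (fun p : T * n.-tuple T => [tuple of p.1 :: p.2])) //=.
exists (fun t : n.+1.-tuple T => (thead t, [tuple of behead t])) => [[x t] _|t _] /=.
  by congr pair; apply: val_inj.
by case/tupleP: t => x t; apply: val_inj.
Qed.

End Mean.

(** The left side collects the terms of degree at most one in [g] of the expanded product. As one
    step makes at most one vertex volunteer, its expected effect has this linear form. *)
Lemma prod_addr_ge (R : realFieldType) (V : eqType) (F : seq V) (b g : V -> R) :
  (forall u, 0 <= b u) -> (forall u, 0 <= g u) ->
  uniq F ->
  \prod_(u <- F) b u + \sum_(u <- F) g u * \prod_(w <- F | w != u) b w
    <= \prod_(u <- F) (b u + g u).
Proof.
move=> b0 g0; elim: F => [|a F IH]; first by rewrite !big_nil addr0.
case/andP=> aF /IH {}IH; rewrite !big_cons eqxx /=.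
have -> : \prod_(w <- F | w != a) b w = \prod_(w <- F) b w.
  rewrite big_seq_cond [RHS]big_seq_cond.
  by apply: eq_bigl => w; case: eqVneq => [->|];
    rewrite ?(negPf aF) ?andbT.
have -> : \sum_(u <- F) g u * \prod_(w <- a :: F | w != u) b w =
    b a * \sum_(u <- F) g u * \prod_(w <- F | w != u) b w.
  rewrite mulr_sumr big_seq [RHS]big_seq; apply: eq_bigr => u uF.
  rewrite big_cons; case: eqVneq => [E|_]; first by rewrite E uF in aF.
  by rewrite mulrCA.
rewrite addrCA addrC -mulrDr mulrDl lerD //; first by rewrite ler_wpM2l.
rewrite ler_wpM2l //; apply: le_trans IH; rewrite lerDl.
by rewrite sumr_ge0 // => u _; rewrite mulr_ge0 // prodr_ge0.
Qed.

(** * Walks and attempts within one step *)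

Section Attempts.
Variables (V : finType) (e : nat -> V * V) (tie : nat -> bool).
Hypothesis tree : forms_tree e.

Let m := #|V|.-1.
Notation low := (low e tie).
Notation high := (high e tie).
Notation in_low := (in_low e tie).
Notation wf_state := (wf_state e tie).
Notation cand := (cand e tie).

Definition first_success (S : state V) v cs : option (seq V) :=
  ohead (filter (success S v) (walks S v cs)).

Lemma stepE t cs S :
  step e tie t cs S = omap (reroute S (low t) (high t)) (first_success S (low t) cs).
Proof. by rewrite /step /low /high; case: (endpoints e tie t). Qed.

Lemma first_success_cons S v b cs : first_success S v (b :: cs) =
  if success S v (walk S v b) then Some (walk S v b) else first_success S v cs.
Proof. by rewrite /first_success /=; case: ifP. Qed.

Lemma first_successP S v cs p : first_success S v cs = Some p ->
  success S v p /\ exists2 b, b \in cs & p = walk S v b.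
Proof.
elim: cs => [//|b cs IH]; rewrite first_success_cons; 
case: ifP => [ok [<-]|_ /IH[ok [b' b'cs Ep]]].
  by split=> //; exists b; rewrite ?mem_head.
by split=> //; exists b' => //; rewrite in_cons b'cs orbT.
Qed.

Lemma wf_step s cs S S' : (s < m)%N -> wf_state s S -> step e tie s cs S = Some S' ->
  wf_state s.+1 S'.
Proof.
rewrite stepE => sm I; case E: (first_success _ _ _) => [p|//] [<-].
have [ok [b _ Ep]] := first_successP E.
by apply: (wf_reroute tree sm I _ ok); rewrite Ep; apply: walk_path I _ _.
Qed.

Lemma wf_run cs t S : (t <= m)%N -> run e tie cs t = Some S -> wf_state t S.
Proof.
elim: t S => [|t IH] S tm /=; first by case=> <-; apply: wf_init.
case E: (run e tie cs t) => [S0|//] /=; apply: wf_step => //.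
by apply: IH E; apply: ltnW.
Qed.

(** Ends of the walks from [v] that make all [j] moves and stop at out-degree at least 2. Every
    other walk succeeds without a volunteer, so only these matter. *)
Fixpoint ends (S : state V) v j : seq V :=
  if (outdeg S v < 2)%N then [::] else
  if j is j'.+1 then
    ends S (nth v (primary S v) 0) j' ++ ends S (nth v (primary S v) 1) j'
  else [:: v].

(** A list, independent of the random bits, of all values that [ends] can take; [[::]] stands for a
    vertex at which the walk terminates early. *)
Fixpoint families j v : seq (seq V) :=
  if j is j'.+1 then
    let fs := flatten [seq families j' y | y <- cand v] in
    [::] :: [seq F ++ G | F <- fs, G <- fs]
  else [:: [::]; [:: v]].

Lemma size_family j v F : F \in families j v -> (size F <= 2 ^ j)%N.
Proof.
elim: j v F => [|j IH] v F /=; first by rewrite !inE => /orP[]/eqP->.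
rewrite inE => /orP[/eqP->//|/allpairsP[[A B] /= []]].
case/flatten_mapP => y _ /IH hA /flatten_mapP[y' _ /IH hB] ->.
by rewrite size_cat expnS mul2n -addnn leq_add.
Qed.

Let L := trunc_log 2 #|V|.

(** With at most [L] choices for each of two children, the number [f] of families obeys
    [f (j + 1) <= 1 + (L * f j) ^ 2]. The factor [2 * L ^ 2] absorbs both [L ^ 2] and the summand 1,
    so that the bound just squares at each level. *)
Lemma size_families j v : (0 < L)%N ->
  (size (families j v) * (2 * L ^ 2) <= (4 * L ^ 2) ^ (2 ^ j))%N.
Proof.
move=> L0; elim: j v => [|j IH] v; first by rewrite expn0 expn1 /= mulnA.
have L2 : (0 < 2 * L ^ 2)%N by rewrite muln_gt0 expn_gt0 L0.
rewrite /=; set X := flatten [seq families j y | y <- cand v].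
rewrite size_allpairs.
set B := ((4 * L ^ 2) ^ 2 ^ j)%N.
have hX : (size X * (2 * L ^ 2) <= L * B)%N.
  apply: (@leq_trans (size (cand v) * B)); last first.
    by rewrite leq_mul2r (size_cand tie tree) orbT.
  rewrite /X; elim: (cand v) => [//|y c IHc] /=.
  by rewrite size_cat mulnDl mulSn leq_add // IH.
have B0 : (0 < B)%N by rewrite expn_gt0 muln_gt0 expn_gt0 L0.
have -> : ((4 * L ^ 2) ^ 2 ^ j.+1 = B * B)%N by rewrite (expnS 2) mul2n -addnn expnD.
have hB : (2 * L ^ 2 <= B)%N by rewrite (leq_trans _ (IH v)) // leq_pmull // ; case: (j).
have h2 : (size X * size X * (2 * L ^ 2) * (2 * L ^ 2) <= L ^ 2 * (B * B))%N.
  by have := leq_mul hX hX; nia.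
rewrite -(leq_pmul2r L2); nia.
Qed.

Section State.
Variables (s : nat) (S : state V).
Hypotheses (sm : (s <= m)%N) (I : wf_state s S).

Lemma ends_path v j u : u \in ends S v j ->
  exists p, path (arc_rel S) v p /\ last v p = u.
Proof.
elim: j v => [|j IH] v /=; case: ltnP => // o2.
  by rewrite inE => /eqP ->; exists [::].
have nx b := primary_arcW (primary_nth I b o2).
by rewrite mem_cat => /orP[]/IH[p [pp lp]];
  [exists (nth v (primary S v) 0 :: p) | exists (nth v (primary S v) 1 :: p)];
  rewrite /= pp lp andbT; split=> //; [apply: (nx false) | apply: (nx true)].
Qed.

(** Walks that part at a vertex cannot meet again in a forest. *)
Lemma uniq_ends v j : uniq (ends S v j).
Proof.
elim: j v => [|j IH] v /=; case: ltnP => // o2.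
rewrite cat_uniq !IH andbT /=; apply/hasPn => u /ends_path[q [pq lq]].
apply/negP => /ends_path[p [pp lp]].
have nx b := primary_arcW (primary_nth I b o2).
have := arc_path_last tree sm I (primary_nth_neq I o2) (v := v) (p := p) (q := q).
by rewrite /= pp pq (nx false) (nx true) lp lq eqxx => /(_ isT isT).
Qed.

Lemma ends_family v j : ends S v j \in families j v.
Proof.
elim: j v => [|j IH] v; first by rewrite /=; case: ltnP; rewrite !inE eqxx ?orbT.
rewrite [ends _ _ _]/= [families _ _]/=; case: ltnP => o2; first exact: mem_head.
have nx b := wf_cand I (primary_arcW (primary_nth I b o2)).
rewrite in_cons; apply/orP; right; apply: allpairs_f; apply/flatten_mapP.
  by exists (nth v (primary S v) 0) => //; apply: (nx false).
by exists (nth v (primary S v) 1) => //; apply: (nx true).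
Qed.

Variable R : realFieldType.

(** Each entry of [ends] belongs to exactly one bit string, hence has probability [1 / 2 ^ j]; walks
    that stop early contribute 0. *)
Lemma mean_walk_end (g : V -> R) v j :
  mean (fun b : j.-tuple bool =>
    if (outdeg S (last v (walk S v b)) < 2)%N then 0
    else g (last v (walk S v b)))
  = (\sum_(u <- ends S v j) g u) / (2 ^ j)%:R.
Proof.
elim: j v => [|j IH] v.
  rewrite (mean_tuple0 (fun b => if (outdeg S (last v (walk S v b)) < 2)%N then 0
    else g (last v (walk S v b)))) /= expn0 divr1 if_same /=.
  by case: ifP; rewrite ?big_nil // big_seq1.
rewrite (mean_tupleS _ (fun b => if (outdeg S (last v (walk S v b)) < 2)%N then 0
    else g (last v (walk S v b)))) /=.
case: ifP => o2.
  by rewrite /= o2 big_nil mul0r !mean_cst ?card_tuple ?card_bool ?expn_gt0.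
rewrite {1}/mean big_bool card_bool /= !IH big_cat /= expnS natrM invfM.
by rewrite -mulrDl addrC [RHS]mulrA mulrAC.
Qed.

Section Step.
Variables (v : V) (j : nat).
Hypothesis good : (2 * count (fun u => outdeg S u == 3%N) (ends S v j) <= 2 ^ j)%N.

Let fail_prob : R := mean (fun b : j.-tuple bool => (~~ success S v (walk S v b))%:R).

Lemma fail_prob_le : fail_prob <= 2^-1.
Proof.
rewrite /fail_prob (eq_mean (g := fun b : j.-tuple bool =>
   if (outdeg S (last v (walk S v b)) < 2)%N then 0
   else (outdeg S (last v (walk S v b)) == 3%N)%:R)); last first.
  move=> b; rewrite /success; have := wf_out I (last v (walk S v b)).
  by case: (outdeg _ _) => [|[|[|[|]]]].
rewrite (mean_walk_end (fun u => (outdeg S u == 3%N)%:R)).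
rewrite -(natr_sum R (ends S v j) xpredT (fun u => (outdeg S u == 3%N) : nat)).
rewrite -big_mkcond sum1_count ler_pdivrMr ?ltr0n ?expn_gt0 //.
by rewrite mulrC ler_pdivlMr // -natrM ler_nat mulnC //.
Qed.

Lemma mean_no_success A :
  mean (fun cs : A.-tuple (j.-tuple bool) =>
    (~~ isSome (first_success S v (map val cs)))%:R) <= 2^-1 ^+ A :> R.
Proof.
pose f (cs : seq (j.-tuple bool)) : R := (~~ isSome (first_success S v (map val cs)))%:R.
rewrite -/(mean (fun cs : A.-tuple (j.-tuple bool) => f cs)).
elim: A => [|A IH]; first by rewrite (mean_tuple0 f) expr0 lern1 leq_b1.
rewrite (mean_tupleS _ f) exprS.
rewrite (eq_mean (g := fun b : j.-tuple bool =>
  mean (fun cs : A.-tuple (j.-tuple bool) => f cs) * (~~ success S v (walk S v b))%:R)).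
  rewrite meanZ mulrC ler_pM ?fail_prob_le ?mean_ge0 // => x; exact: ler0n.
move=> b; rewrite /f /= mulrC -meanZ; apply: eq_mean => cs.
by rewrite first_success_cons; case: ifP => _; rewrite /= ?mul0r ?mul1r.
Qed.

Definition volunteers (o : option (seq V)) u :=
  if o is Some p then (last v p == u) && (outdeg S u == 2%N) else false.

(** A single attempt ends at a volunteering [u] with probability at most [1 / 2 ^ j], as [ends] has
    no repetition. With probability at most 1/2 it fails and the procedure starts anew, so a
    geometric series yields the factor 2. *)
Lemma mean_volunteers A u :
  mean (fun cs : A.-tuple (j.-tuple bool) =>
    (volunteers (first_success S v (map val cs)) u)%:R) <= 2 / (2 ^ j)%:R :> R.
Proof.
pose f (cs : seq (j.-tuple bool)) : R := (volunteers (first_success S v (map val cs)) u)%:R.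
rewrite -/(mean (fun cs : A.-tuple (j.-tuple bool) => f cs)).
have P0 : 0 <= (2 ^ j)%:R^-1 :> R by rewrite invr_ge0 ler0n.
elim: A => [|A IH]; first by rewrite (mean_tuple0 f) mulr_ge0.
rewrite (mean_tupleS _ f).
pose M := mean (fun cs : A.-tuple (j.-tuple bool) => f cs).
rewrite (eq_mean (g := fun b : j.-tuple bool =>
   (if (outdeg S (last v (walk S v b)) < 2)%N then 0
    else ((last v (walk S v b) == u) && (outdeg S u == 2%N))%:R) +
   M * (~~ success S v (walk S v b))%:R)).
  rewrite meanD meanZ (mean_walk_end (fun w => ((w == u) && (outdeg S u == 2%N))%:R)).
  (* The claimed bound is the fixed point of this recursion. *)
  have -> : 2 / (2 ^ j)%:R = 1 / (2 ^ j)%:R + 2 / (2 ^ j)%:R * 2^-1 :> R.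
    by rewrite mulrAC divff ?pnatr_eq0 // mul1r -mulr2n mulr_natl.
  apply: lerD; last first.
    apply: ler_pM => //; last exact: fail_prob_le.
      by apply: mean_ge0 => x; apply: ler0n.
    by apply: mean_ge0 => x; apply: ler0n.
  rewrite ler_wpM2r // -(natr_sum R (ends S v j) xpredT
    (fun w => ((w == u) && (outdeg S u == 2%N)) : nat)).
  rewrite lern1; apply: (@leq_trans (\sum_(w <- ends S v j) (w == u))).
    by apply: leq_sum => w _; case: (w == u) => //=; apply: leq_b1.
  by rewrite -big_mkcond sum1_count count_uniq_mem ?uniq_ends ?leq_b1.
move=> b; rewrite /M mulrC -meanZ.
rewrite (eq_mean (g := fun cs : A.-tuple (j.-tuple bool) =>
  ((success S v (walk S v b)) && (last v (walk S v b) == u) && (outdeg S u == 2%N))%:R +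
  (~~ success S v (walk S v b))%:R * f cs)).
  rewrite meanD mean_cst; last by rewrite card_tuple expn_gt0 card_tuple expn_gt0 card_bool.
  congr (_ + _); rewrite /success; case: eqVneq => [->|_]; last by rewrite andbF if_same.
  by rewrite andbT; case: (outdeg S u) => [|[|[|[|]]]].
move=> cs; rewrite /f /= first_success_cons; case: ifP => _ /=.
  by rewrite mul0r addr0.
by rewrite mul1r add0r.
Qed.

End Step.
End State.
End Attempts.

(** * The supermartingale *)

Section Potential.
Variables (V : finType) (e : nat -> V * V) (tie : nat -> bool).
Hypothesis tree : forms_tree e.
Variables (R : realFieldType) (j A : nat).

Let m := #|V|.-1.
Let L := trunc_log 2 #|V|.
Notation low := (low e tie).
Notation high := (high e tie).
Notation in_low := (in_low e tie).
Notation wf_state := (wf_state e tie).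

(* The weight of a volunteer is the reciprocal of [L * (2 / 2 ^ j)], which
   bounds the probability that a given vertex ever volunteers; with this choice
   every vertex starts with weight at most 2. *)
Let x : R := (2 ^ j)%:R / (2 * L%:R).

Hypotheses (L0 : (0 < L)%N) (j0 : (0 < j)%N) (x1 : 1 <= x).

Definition remaining s w := low_count e tie s (m - s) w.

Lemma remaining_step s w : (s < m)%N -> remaining s w = (in_low s w + remaining s.+1 w)%N.
Proof. by move=> sm; rewrite /remaining -(subnSK sm). Qed.

(** Each later step with [u] in the lower tree can raise the expected weight by at most [1 / L]; the
    term with [remaining] pays for this in advance. *)
Definition weight s (S : state V) u : R :=
  if outdeg S u == 3%N then x else 1 + L%:R^-1 * (remaining s u)%:R.

Lemma weight_ge1 s S u : 1 <= weight s S u.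
Proof. by rewrite /weight; case: ifP => // _; rewrite lerDl mulr_ge0 ?invr_ge0 ?ler0n. Qed.

Lemma weight_ge0 s S u : 0 <= weight s S u.
Proof. exact: le_trans (weight_ge1 s S u). Qed.

Lemma weight_reroute s S p w : (s < m)%N -> wf_state s S ->
  path (primary_arc S) (low s) p -> (outdeg S (last (low s) p) < 3)%N ->
  weight s.+1 (reroute S (low s) (high s) p) w =
  if (w == last (low s) p) && (outdeg S w == 2%N) then x else weight s.+1 S w.
Proof.
move=> sm I pp fit; rewrite /weight (outdeg_reroute tree sm I pp).
case: (eqVneq w (last (low s) p)) => [->|_] /=; last by rewrite addn0.
by move: fit; case: (outdeg S _) => [|[|[|]]].
Qed.

Section Step.
Variables (s : nat) (S : state V).
Hypotheses (sm : (s < m)%N) (I : wf_state s S).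
Hypothesis good :
  (2 * count (fun u => outdeg S u == 3%N) (ends S (low s) j) <= 2 ^ j)%N.

Let attempt (cs : A.-tuple (j.-tuple bool)) := first_success S (low s) (map val cs).

Lemma volunteers_low cs u :
  volunteers S (low s) (attempt cs) u -> in_low s u && (outdeg S u == 2%N).
Proof.
rewrite /attempt; case E: first_success => [p|//] /= /andP[/eqP <- ->].
rewrite andbT; have [_ [b _ ->]] := first_successP E.
apply/connectP; exists (walk S (low s) b) => //.
apply: sub_path (walk_path I (low s) b) => y z yz.
exact: (arc_forest I (primary_arcW yz)).
Qed.

(** Only the volunteer, if there is one in [F], has its factor replaced by [x]. A declared failure
    counts as 0 here and is accounted for separately. *)
Lemma prod_weight_step (cs : A.-tuple (j.-tuple bool)) F : uniq F ->
  oapp (fun S' => \prod_(u <- F) weight s.+1 S' u) 0 (step e tie s (map val cs) S)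
  <= \prod_(u <- F) weight s.+1 S u +
     \sum_(u <- F) (volunteers S (low s) (attempt cs) u)%:R *
                   (x * \prod_(w <- F | w != u) weight s.+1 S w).
Proof.
move=> uF; have x0 : 0 <= x by apply: le_trans x1.
have P0 P : 0 <= \prod_(w <- F | P w) weight s.+1 S w.
  by apply: prodr_ge0 => w _; apply: weight_ge0.
have T0 P : 0 <= \sum_(u <- F | P u) (volunteers S (low s) (attempt cs) u)%:R *
                   (x * \prod_(w <- F | w != u) weight s.+1 S w).
  by apply: sumr_ge0 => u _; rewrite mulr_ge0 ?ler0n // mulr_ge0 ?(P0 (fun w => w != u)).
rewrite stepE -/(attempt cs); case E: (attempt cs) (T0) => [p|] {}T0 /=; last exact: addr_ge0.
have [fit [b _ Ep]] := first_successP E.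
have pp : path (primary_arc S) (low s) p by rewrite Ep; apply: walk_path I _ _.
rewrite (eq_bigr (fun w => if (w == last (low s) p) && (outdeg S w == 2%N)
  then x else weight s.+1 S w)); last by move=> w _; apply: weight_reroute.
set u := last (low s) p.
have [o2|o2] := boolP ((u \in F) && (outdeg S u == 2%N)); last first.
  rewrite (eq_big_seq (weight s.+1 S)) => [|w wF].
    by rewrite lerDl; apply: (T0 xpredT).
  by case: eqVneq => [wu|//] /=; move: o2; rewrite -wu wF /= => /negPf ->.
case/andP: o2 => uF' o2; rewrite (bigD1_seq u) //= eqxx o2 /=.
rewrite [\sum_(i <- F) _](bigD1_seq u) //= eqxx o2 /= mul1r.
rewrite (eq_bigr (weight s.+1 S)); last by move=> w /negPf ->.
by rewrite addrCA lerDl addr_ge0 ?(P0 xpredT) ?(T0 (fun w => w != u)).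
Qed.

Lemma mean_prod_weight F : uniq F ->
  mean (fun cs : A.-tuple (j.-tuple bool) =>
    oapp (fun S' => \prod_(u <- F) weight s.+1 S' u) 0 (step e tie s (map val cs) S))
  <= \prod_(u <- F) weight s S u.
Proof.
move=> uF; apply: le_trans (le_mean (fun cs => prod_weight_step cs uF)) _.
rewrite meanD mean_cst; last by rewrite card_tuple expn_gt0 card_tuple expn_gt0 card_bool.
rewrite mean_sum.
(* The value [1 / L] is [x] times the bound [2 / 2 ^ j] on the probability of volunteering. *)
pose g u : R := (in_low s u && (outdeg S u == 2%N))%:R / L%:R.
apply: (@le_trans _ _ (\prod_(u <- F) (weight s.+1 S u + g u))).
  apply: le_trans (prod_addr_ge _ _ uF); last first.
  - by move=> u; rewrite divr_ge0 ?ler0n.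
  - by move=> u; apply: weight_ge0.
  rewrite lerD2l; apply: ler_sum => u _.
  rewrite (eq_mean (g := fun cs => (x * \prod_(w <- F | w != u) weight s.+1 S w) *
     (volunteers S (low s) (attempt cs) u)%:R)); last by move=> cs; rewrite mulrC.
  rewrite meanZ mulrAC ler_wpM2r //.
    by apply: prodr_ge0 => w _; apply: weight_ge0.
  rewrite /g; case: (boolP (in_low s u && _)) => [_|nv]; last first.
    rewrite (eq_mean (g := fun=> 0)) => [|cs]; last first.
      by case: (boolP (volunteers _ _ _ _)) => // /volunteers_low; rewrite (negPf nv).
    by rewrite mean_cst ?mulr0 ?mul0r // card_tuple expn_gt0 card_tuple expn_gt0 card_bool.
  have x0 : 0 <= x by apply: le_trans x1.
  apply: (@le_trans _ _ (x * (2 / (2 ^ j)%:R))).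
    by apply: ler_wpM2l => //; apply: (mean_volunteers tree (ltnW sm) I R good).
  have E (a b : R) : a != 0 -> b != 0 -> a / (2 * b) * (2 / a) = 1 / b.
    by move=> a0 b0; field; rewrite a0 b0.
  by rewrite /x E ?pnatr_eq0 ?expn_eq0 // -lt0n.
(* The drop of [remaining] at a vertex of the lower tree pays for [g u]; at out-degree 3 the term
   [g u] vanishes. *)
rewrite !big_seq; apply: ler_prod => u uF'; rewrite addr_ge0 ?weight_ge0 ?divr_ge0 ?ler0n //=.
rewrite /weight /g (remaining_step u sm); case: eqVneq => [->|_] /=.
  by rewrite andbF mul0r addr0.
rewrite -addrA lerD2l natrD mulrDr addrC lerD2r mulrC ler_wpM2l ?invr_ge0 ?ler0n //.
by rewrite ler_nat; case: (in_low s u) => //=; case: (_ == _).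
Qed.

End Step.

(** Which step turns bad, and with which family, is unknown beforehand, so the union bound is built
    in as a sum over all starts and all families. *)
Definition potential s S : R :=
  \sum_(t < m) \sum_(F <- families e tie j (low t) | uniq F) \prod_(u <- F) weight s S u.

Lemma potential_ge0 s S : 0 <= potential s S.
Proof.
by do 2!apply: sumr_ge0 => ? _; apply: prodr_ge0 => u _; apply: weight_ge0.
Qed.

Lemma mean_potential s S : (s < m)%N -> wf_state s S ->
  (2 * count (fun u => outdeg S u == 3%N) (ends S (low s) j) <= 2 ^ j)%N ->
  mean (fun cs : A.-tuple (j.-tuple bool) =>
    oapp (potential s.+1) 0 (step e tie s (map val cs) S)) <= potential s S.
Proof.
move=> sm I good.
rewrite (eq_mean (g := fun cs : A.-tuple (j.-tuple bool) =>
  \sum_(t < m) \sum_(F <- families e tie j (low t) | uniq F)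
   oapp (fun S' => \prod_(u <- F) weight s.+1 S' u) 0 (step e tie s (map val cs) S))).
  rewrite mean_sum; apply: ler_sum => t _; rewrite mean_sum.
  by apply: ler_sum => F uF; apply: mean_prod_weight.
move=> cs; case: (step _ _ _ _ _) => [S'|] //=.
by rewrite big1 // => t _; rewrite big1.
Qed.

(** The actual list of ends is one of the summands; at least [2 ^ j.-1] of its factors equal [x],
    and all others are at least 1. *)
Lemma potential_bad s S : (s < m)%N -> wf_state s S ->
  (2 ^ j < 2 * count (fun u => outdeg S u == 3%N) (ends S (low s) j))%N ->
  x ^+ (2 ^ j.-1) <= potential s S.
Proof.
move=> sm I bad; set c := count _ _ in bad.
have x0 : 0 <= x by apply: le_trans x1.
have jc : (2 ^ j.-1 <= c)%N by move: bad; rewrite -{1}(prednK j0) expnS ltn_mul2l => /ltnW.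
apply: (@le_trans _ _ (x ^+ c)); first exact: ler_weXn2l.
have P0 F : 0 <= \prod_(u <- F) weight s S u by apply: prodr_ge0 => u _; apply: weight_ge0.
rewrite /potential (bigD1 (Ordinal sm)) //= -[x ^+ c]addr0; apply: lerD; last first.
  by do 2!apply: sumr_ge0 => ? _.
have En := ends_family I (low s) j.
rewrite (big_rem _ En) /= (uniq_ends tree (ltnW sm) I) -[x ^+ c]addr0; apply: lerD; last first.
  by apply: sumr_ge0.
rewrite /c; elim: (ends _ _ _) => [|u F IH]; first by rewrite big_nil.
rewrite big_cons /= exprD; apply: ler_pM; rewrite ?exprn_ge0 //.
by case: eqP => [Eu|_]; rewrite ?expr0 ?weight_ge1 // /weight Eu eqxx.
Qed.

(** A product of at most [2 ^ j] initial weights is at most [2 ^ (2 ^ j)], which together with the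
    number of families turns the base [4 * L ^ 2] into [8 * L ^ 2]. *)
Lemma potential_init : potential 0 (@init V) <= m%:R * ((8 * L ^ 2) ^ (2 ^ j))%:R.
Proof.
have W2 u : weight 0 (@init V) u <= 2.
  rewrite /weight outdeg_init /= -[2]/(1 + 1) lerD2l mulrC ler_pdivrMr ?ltr0n // mul1r ler_nat.
  by rewrite /remaining subn0; apply: (low_count_le tie tree).
have PW F : \prod_(u <- F) weight 0 (@init V) u <= 2 ^+ size F.
  elim: F => [|u F IH]; first by rewrite big_nil.
  rewrite big_cons exprS; apply: ler_pM; rewrite ?weight_ge0 ?W2 //.
  by apply: prodr_ge0 => w _; apply: weight_ge0.
have each v : \sum_(F <- families e tie j v | uniq F) \prod_(u <- F) weight 0 (@init V) u
    <= ((8 * L ^ 2) ^ (2 ^ j))%:R.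
  apply: (@le_trans _ _ (\sum_(F <- families e tie j v) 2 ^+ (2 ^ j))).
    rewrite big_mkcond !big_seq; apply: ler_sum => F /size_family sF.
    case: ifP => _; last by rewrite exprn_ge0.
    by apply: le_trans (PW F) _; apply: ler_weXn2l => //; rewrite ler1n.
  rewrite big_const_seq count_predT iter_addr addr0 -natrX.
  rewrite -mulrnA ler_nat -[8%N]/(2 * 4)%N -mulnA expnMn leq_mul2l; apply/orP; right.
  apply: leq_trans (size_families tie tree _ v L0).
  by rewrite leq_pmulr // muln_gt0 expn_gt0 L0.
apply: (@le_trans _ _ (\sum_(t < m) ((8 * L ^ 2) ^ (2 ^ j))%:R)).
  by apply: ler_sum => t _; apply: each.
by rewrite sumr_const card_ord mulr_natl.
Qed.

Fixpoint run_from s S (css : seq (seq (seq bool))) : option (state V) :=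
  if css is cs :: css' then
    obind (fun S' => run_from s.+1 S' css') (step e tie s cs S)
  else Some S.

Lemma run_from_rcons s S css cs : run_from s S (rcons css cs) =
  obind (step e tie (s + size css) cs) (run_from s S css).
Proof.
elim: css s S => [|c css IH] s S /=; first by rewrite addn0; case: step.
by case: step => //= S'; rewrite IH addSnnS.
Qed.

Lemma run_fromE css t : (t <= size css)%N ->
  run e tie (nth [::] css) t = run_from 0 (@init V) (take t css).
Proof.
elim: t => [|t IH] tc /=; first by rewrite take0.
rewrite (take_nth [::] tc) run_from_rcons add0n size_takel ?(ltnW tc) //.
by rewrite IH // ltnW.
Qed.

(** Either a bad step occurs, which Markov's inequality for the potential controls, or all [A]
    attempts of a good step fail, with probability at most [2^-1 ^+ A] for each step. *)
Lemma mean_failure s r S : (s + r = m)%N -> wf_state s S ->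
  mean (fun w : r.-tuple (A.-tuple (j.-tuple bool)) =>
    (~~ isSome (run_from s S (map (fun cs => map val (val cs)) w)))%:R)
  <= potential s S / x ^+ (2 ^ j.-1) + r%:R * 2^-1 ^+ A.
Proof.
pose f s S (w : seq (A.-tuple (j.-tuple bool))) : R :=
  (~~ isSome (run_from s S (map (fun cs => map val (val cs)) w)))%:R.
have xk0 : 0 < x ^+ (2 ^ j.-1) by rewrite exprn_gt0 // (lt_le_trans _ x1).
have T0 n : (0 < #|{: n.-tuple (A.-tuple (j.-tuple bool))}|)%N.
  by rewrite card_tuple expn_gt0 card_tuple expn_gt0 card_tuple expn_gt0 card_bool.
have T1 : (0 < #|{: A.-tuple (j.-tuple bool)}|)%N.
  by rewrite card_tuple expn_gt0 card_tuple expn_gt0 card_bool.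
have d0 : 0 <= 2^-1 ^+ A :> R by rewrite exprn_ge0 // invr_ge0.
elim: r s S => [|r IH] s S srm I.
  rewrite (mean_tuple0 (f s S)) /f /= mul0r addr0.
  by rewrite divr_ge0 ?potential_ge0 // ltW.
have sm : (s < m)%N by rewrite -srm addnS ltnS leq_addr.
have [good|bad] :=
  leqP (2 * count (fun u => outdeg S u == 3%N) (ends S (low s) j)) (2 ^ j); last first.
  (* At a bad step the potential term alone is at least 1. *)
  apply: (@le_trans _ _ 1).
    rewrite -[X in _ <= X](mean_cst _ (T0 r.+1)); apply: le_mean => w.
    by rewrite lern1 leq_b1.
  apply: ler_wpDr; first by rewrite mulr_ge0 ?ler0n.
  by rewrite ler_pdivlMr // mul1r; apply: potential_bad.
rewrite (mean_tupleS _ (f s S)).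
apply: (@le_trans _ _ (mean (fun cs : A.-tuple (j.-tuple bool) =>
   (~~ isSome (first_success S (low s) (map val cs)))%:R +
   ((x ^+ (2 ^ j.-1))^-1 * oapp (potential s.+1) 0 (step e tie s (map val cs) S) +
   r%:R * 2^-1 ^+ A)))).
  apply: le_mean => cs; rewrite /f /= stepE; case E: first_success => [p|] /=; last first.
    by rewrite mean_cst // lerDl mulr0 add0r mulr_ge0.
  rewrite add0r mulrC; apply: IH; first by rewrite addSnnS.
  by apply: (wf_step tree sm I (cs := map val cs)); rewrite stepE E.
rewrite !meanD meanZ mean_cst //.
have -> : potential s S / x ^+ (2 ^ j.-1) + r.+1%:R * 2^-1 ^+ A =
    2^-1 ^+ A + ((x ^+ (2 ^ j.-1))^-1 * potential s S + r%:R * 2^-1 ^+ A).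
  by rewrite -[r.+1]addn1 natrD mulrDl mul1r mulrC [_ + 2^-1 ^+ A]addrC addrCA.
apply: lerD; first exact: (mean_no_success I R good).
apply: lerD => //; apply: ler_wpM2l; first by rewrite invr_ge0 ltW.
exact: mean_potential.
Qed.

End Potential.

(** * Numerical bounds *)

Section Logarithms.
Variable R : realType.

Lemma ln2_gt0 : 0 < ln 2 :> R.
Proof. by rewrite ln_gt0 // ltr1n. Qed.

Lemma log2_le (x y : R) : 0 < x -> x <= y -> log2 x <= log2 y.
Proof.
move=> x0 xy; rewrite ler_wpM2r ?invr_ge0 ?(ltW ln2_gt0) // ler_ln ?posrE //.
exact: lt_le_trans xy.
Qed.

Lemma log2_gt0 (x : R) : 1 < x -> 0 < log2 x.
Proof. by move=> x1; rewrite divr_gt0 ?ln2_gt0 // ln_gt0. Qed.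

Lemma log2_mul_le (x : R) k N : 0 < x -> k%:R * log2 x <= N%:R -> x ^+ k <= 2 ^+ N.
Proof.
move=> x0; rewrite /log2 mulrA ler_pdivrMr ?ln2_gt0 // => H.
rewrite -ler_ln ?posrE ?exprn_gt0 // !lnXn ?exprn_gt0 //.
by rewrite -[_ *+ k]mulr_natl -[_ *+ N]mulr_natl.
Qed.

Lemma log2_ge (x : R) k N : 0 < x -> 2 ^+ N <= x ^+ k -> N%:R <= k%:R * log2 x.
Proof.
move=> x0; rewrite -ler_ln ?posrE ?exprn_gt0 // !lnXn ?exprn_gt0 // => H.
rewrite /log2 mulrA ler_pdivlMr ?ln2_gt0 //.
by rewrite -[_ *+ k]mulr_natl -[_ *+ N]mulr_natl in H.
Qed.

Lemma trunc_log_le_log2 n : (0 < n)%N -> (trunc_log 2 n)%:R <= log2 n%:R :> R.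
Proof.
move=> n0; rewrite -[log2 _]mul1r; apply: (@log2_ge _ 1); rewrite ?ltr0n // expr1.
by rewrite -natrX ler_nat trunc_logP.
Qed.

(** From [2 ^ 3 <= 3 ^ 2]. A bound strictly above 1 keeps [log2 (log2 n)] away from 0. *)
Lemma log2_ge_3_2 n : (2 < n)%N -> 3 / 2 <= log2 n%:R :> R.
Proof.
move=> n2; rewrite ler_pdivrMr ?ltr0n // mulrC; apply: log2_ge.
  by rewrite ltr0n (ltn_trans _ n2).
rewrite -!natrX ler_nat; apply: (@leq_trans (3 ^ 2)) => //.
by rewrite leq_exp2r.
Qed.

Lemma natr_ceil_ge (y : R) : 0 <= y -> y <= `|Num.ceil y|%N%:R.
Proof.
move=> y0; have c0 : 0 <= Num.ceil y by rewrite ceil_ge0 (lt_le_trans _ y0) // ltrN10.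
by rewrite natr_absz ger0_norm // ceil_ge.
Qed.

Lemma natr_ceil_le (y : R) : 0 <= y -> `|Num.ceil y|%N%:R <= y + 1.
Proof.
move=> y0; have c0 : 0 <= Num.ceil y by rewrite ceil_ge0 (lt_le_trans _ y0) // ltrN10.
rewrite natr_absz ger0_norm //.
by have := ceilB1_lt y; rewrite intrB ltrBlDr => /ltW.
Qed.

End Logarithms.

(** * Runs driven by a random sample *)

Section Sampling.
Variables (R : realType) (c d : R) (V : finType) (e : nat -> V * V) (tie : nat -> bool).
Hypothesis tree : forms_tree e.

Notation n := #|V|.
Notation m := #|V|.-1.
Notation low := (low e tie).
Notation high := (high e tie).
Implicit Type omega : sample c d n.

Lemma coins_nth omega t : (t < m)%N ->
  exists s : (max_attempts d n).-tuple ((max_moves c n).-tuple bool),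
    coins omega t = [seq val b | b <- val s].
Proof.
move=> tm; pose s0 : (max_attempts d n).-tuple ((max_moves c n).-tuple bool) :=
  nseq_tuple _ (nseq_tuple _ false).
by exists (nth s0 omega t); rewrite /coins (nth_map s0) // size_tuple.
Qed.

Lemma size_coins omega t : (t < m)%N -> size (coins omega t) = max_attempts d n.
Proof. by case/(coins_nth omega) => s ->; rewrite size_map size_tuple. Qed.

Lemma size_coins_bits omega t b :
  (t < m)%N -> b \in coins omega t -> size b = max_moves c n.
Proof. by case/(coins_nth omega) => s -> /mapP[b' _ ->]; rewrite size_tuple. Qed.

Lemma run_coinsE omega : run e tie (coins omega) m =
  run_from e tie 0 (@init V) [seq [seq val b | b <- val cs] | cs <- val omega].
Proof.
have := @run_fromE V e tie [seq [seq val b | b <- val cs] | cs <- val omega] m.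
by rewrite size_map size_tuple leqnn take_oversize ?size_map ?size_tuple // => /(_ isT) <-.
Qed.

Lemma card_sample_gt0 : (0 < #|sample c d n|)%N.
Proof. by rewrite card_tuple expn_gt0 card_tuple expn_gt0 card_tuple expn_gt0 card_bool. Qed.

Lemma Pr_success (eps : R) :
  mean (fun omega : sample c d n => (~~ isSome (run e tie (coins omega) m))%:R) <= eps ->
  1 - eps <= Pr R [set omega : sample c d n | isSome (run e tie (coins omega) m)].
Proof.
move=> H; rewrite lerBlDr; apply: le_trans (lerD (lexx _) H).
have -> : Pr R [set omega : sample c d n | isSome (run e tie (coins omega) m)] =
    mean (fun omega : sample c d n => (isSome (run e tie (coins omega) m))%:R).
  rewrite /Pr /mean -sum1_card natr_sum; congr (_ / _); rewrite big_mkcond /=.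
  by apply: eq_bigr => omega _; rewrite inE; case: isSome.
rewrite -meanD -[leLHS](mean_cst _ card_sample_gt0); apply: le_mean => omega.
by case: isSome; rewrite /= ?addr0 ?add0r.
Qed.

(** At most one edge arrives, and in the empty orientation its walk succeeds without a move; [0 < d]
    provides at least one attempt. *)
Lemma run_small omega : 0 < d -> (n <= 2)%N -> isSome (run e tie (coins omega) m).
Proof.
move=> d0 n2; have [m0|m0] := posnP m; first by rewrite m0.
have En : n = 2%N by apply/eqP; rewrite eqn_leq n2 -ltnS; case: (n) m0 => [|[|]].
have Em : m = 1%N by rewrite En.
rewrite Em /= stepE; have := size_coins omega m0.
have A0 : (0 < max_attempts d n)%N.
  rewrite /max_attempts En /log2 divff ?mulr1 ?gt_eqF ?ln2_gt0 //.
  rewrite lt0n -(eqr_nat R) gt_eqF //; apply: lt_le_trans d0 (natr_ceil_ge (ltW d0)).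
case: (coins omega 0) => [|b bs] /=; first by move=> E; rewrite -E in A0.
move=> _; rewrite first_success_cons.
by rewrite /success outdeg_init.
Qed.

Lemma run_stepE omega t S S' : (t < m)%N ->
  run e tie (coins omega) t = Some S -> run e tie (coins omega) t.+1 = Some S' ->
  wf_state e tie t S /\ exists p, [/\ path (primary_arc S) (low t) p,
    (outdeg S (last (low t) p) < 3)%N, (size p <= max_moves c n)%N &
    S' = reroute S (low t) (high t) p].
Proof.
move=> tm Et; rewrite /= Et /= stepE; have I := wf_run tree (ltnW tm) Et.
case E: first_success => [p|//] [<-]; split=> //; exists p.
have [ok [b bc Ep]] := first_successP E.
split=> //; rewrite Ep; first exact: walk_path I _ _.
by rewrite -(size_coins_bits tm bc) size_walk.
Qed.

Lemma flips_le omega t S S' : (t < m)%N ->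
  run e tie (coins omega) t = Some S -> run e tie (coins omega) t.+1 = Some S' ->
  (flips S S' <= max_moves c n)%N.
Proof.
move=> tm E /(run_stepE tm E) [I [p [pp fit sp ->]]].
by apply: leq_trans sp; apply: (flips_reroute tree tm I).
Qed.

Lemma step_time_le (k : cost_model) rank_time omega t S S' : (t < m)%N ->
  rank_time_ok k e rank_time ->
  run e tie (coins omega) t = Some S -> run e tie (coins omega) t.+1 = Some S' ->
  (step_time k e tie rank_time t (coins omega t) S S' <=
   rank_cost k * (1 + trunc_log 2 n) +
   max_attempts d n * (attempt_cost k + move_cost k * max_moves c n) +
   flip_cost k * max_moves c n + insert_cost k)%N.
Proof.
move=> tm rk Et Et'; rewrite /step_time leq_add2r; apply: leq_add; last first.
  by rewrite leq_mul2l (flips_le tm Et Et') orbT.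
apply: leq_add.
  apply: leq_trans (rk t tm) _; rewrite leq_mul2l leq_add2l geq_min.
  by rewrite (crank_le tree _ (ltnW tm)) orbT.
set ps := attempts _ _ _; set K := (_ + _)%N.
have sz : (size ps <= max_attempts d n)%N.
  rewrite /ps /attempts size_take_min; apply: leq_trans (geq_minr _ _) _.
  by rewrite /walks size_map size_coins.
have bd p : p \in ps -> (attempt_cost k + move_cost k * size p <= K)%N.
  move=> /mem_take /mapP[b bc ->]; rewrite leq_add2l leq_mul2l.
  by rewrite -(size_coins_bits tm bc) size_walk orbT.
rewrite big_seq; apply: (@leq_trans (\sum_(p <- ps | p \in ps) K)); first exact: leq_sum.
by rewrite -big_seq big_const_seq count_predT iter_addn_0 mulnC leq_mul2r sz orbT.
Qed.

End Sampling.

(** * Choice of constants and asymptotic bounds *)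

Section Bounds.
Variable R : realType.

Lemma pow_max_moves n (c : R) N : (2 < n)%N -> N%:R <= c ->
  log2 n%:R ^+ N <= 2 ^+ max_moves c n :> R.
Proof.
move=> n2 Nc; have l1 : 1 < log2 n%:R :> R by apply: lt_le_trans (log2_ge_3_2 R n2); lra.
have ll := log2_gt0 l1; apply: log2_mul_le; first exact: lt_trans l1.
apply: (@le_trans _ _ (c * log2 (log2 n%:R))); first by rewrite ler_pM2r.
by apply: natr_ceil_ge; rewrite mulr_ge0 ?(ltW ll) // (le_trans _ Nc).
Qed.

(** Since [2 <= l ^+ 2], the constant 256 costs 16 powers of [l] and [L ^ 5] costs 5, whence 21; the
    factor [2 * B <= 2 ^ (2 * B)] costs [4 * B] powers, and [l] itself one more. *)
Lemma pow_ge (l : R) (L B : nat) : 3 / 2 <= l -> L%:R <= l ->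
  256 * L%:R ^+ 5 <= l ^+ (21 + 4 * B) /\ 2 * (B%:R * l) <= l ^+ (21 + 4 * B).
Proof.
move=> l32 Ll; have l1 : 1 <= l by lra.
have l0 : 0 <= l by lra.
have l2 : 2 <= l ^+ 2 by rewrite expr2; apply: le_trans (ler_pM _ _ l32 l32); lra.
have pow2 k : 2 ^+ k <= l ^+ (2 * k).
  by rewrite exprM; apply: lerXn2r; rewrite ?nnegrE // exprn_ge0.
split.
  rewrite (_ : 21 + 4 * B = 2 * 8 + (5 + 4 * B))%N; last by lia.
  rewrite exprD; apply: ler_pM; rewrite ?exprn_ge0 ?ler0n //.
    by apply: le_trans (pow2 8); rewrite -natrX ler_nat.
  rewrite exprD -[_ ^+ 5]mulr1; apply: ler_pM; rewrite ?exprn_ge0 ?ler0n ?exprn_ege1 //.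
  by apply: lerXn2r; rewrite ?nnegrE ?ler0n.
rewrite (_ : 21 + 4 * B = 20 + (2 * (2 * B)).+1)%N; last by lia.
rewrite exprD -[leLHS]mul1r; apply: ler_pM; rewrite ?exprn_ege1 ?mulr_ge0 ?ler0n //.
rewrite exprSr mulrA; apply: ler_wpM2r => //.
apply: le_trans (pow2 _); rewrite -natrM -natrX ler_nat.
by have := ltn_expl (2 * B) (isT : 1 < 2)%N; apply: ltnW.
Qed.

(** The first bound on [2 ^+ j] gives [(8 * L ^ 2) ^ 2 / x <= 1 / 2], so the potential term is at
    most [n / 2 ^ k] with [k = 2 ^ j.-1]. The second gives [B * log2 n <= k], which makes both terms
    at most [n * n ^- B]. *)
Lemma union_bound (a : R) (n B j A L : nat) :
  let x : R := (2 ^ j)%:R / (2 * L%:R) in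
  (2 < n)%N -> (0 < L)%N -> a + 2 <= B%:R -> 256 * L%:R ^+ 5 <= 2 ^+ j :> R ->
  2 * (B%:R * log2 n%:R) <= 2 ^+ j :> R -> B%:R * log2 n%:R <= A%:R :> R ->
  [/\ (0 < j)%N, 1 <= x &
   n.-1%:R * ((8 * L ^ 2) ^ (2 ^ j))%:R / x ^+ (2 ^ j.-1) + n.-1%:R * 2^-1 ^+ A
     <= 1 / n%:R `^ a].
Proof.
move=> x n2 L0 aB P1 P2 HA.
have j0 : (0 < j)%N.
  rewrite lt0n; apply/eqP => E; move: P1; rewrite E expr0 -natrX -natrM lern1 leqNgt.
  by rewrite (@leq_trans 256) // leq_pmulr // expn_gt0 L0.
pose k := (2 ^ j.-1)%N.
have Ek : 2 ^+ j = 2 * k%:R :> R by rewrite natrX -exprS prednK.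
have x2 : 128 * L%:R ^+ 4 <= x.
  rewrite /x natrX ler_pdivlMr ?mulr_gt0 ?ltr0n //; apply: le_trans P1.
  by rewrite mulrACA -exprSr -natrM.
have x1 : 1 <= x.
  by apply: le_trans x2; rewrite -natrX -natrM ler1n muln_gt0 expn_gt0 L0.
have x0 : 0 < x by apply: lt_le_trans x1.
have n0 : 0 < n%:R :> R by rewrite ltr0n (ltn_trans _ n2).
have half N : B%:R * log2 n%:R <= N%:R :> R -> 2^-1 ^+ N <= n%:R ^- B :> R.
  move=> H; rewrite exprVn lef_pV2 ?posrE ?exprn_gt0 //; exact: log2_mul_le.
have Hk : 2^-1 ^+ k <= n%:R ^- B :> R by apply: half; rewrite -(ler_pM2l (ltr0Sn R 1)) -Ek.
have nm : n.-1%:R <= n%:R :> R by rewrite ler_nat leq_pred.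
have T1 : n.-1%:R * ((8 * L ^ 2) ^ (2 ^ j))%:R / x ^+ k <= n%:R * n%:R ^- B :> R.
  rewrite -mulrA; apply: ler_pM; rewrite ?ler0n ?mulr_ge0 ?ler0n ?invr_ge0 ?exprn_ge0 ?(ltW x0) //.
  apply: le_trans Hk.
  have -> : (2 ^ j = 2 * k)%N by rewrite -expnS prednK.
  rewrite natrX exprM -expr_div_n; apply: lerXn2r.
  - by rewrite nnegrE divr_ge0 ?exprn_ge0 ?ler0n ?(ltW x0).
  - by rewrite nnegrE invr_ge0.
  rewrite ler_pdivrMr // mulrC ler_pdivlMr ?ltr0n //.
  apply: le_trans x2; rewrite -!natrX -!natrM ler_nat.
  by rewrite expnMn -expnM -mulnA [(_ * 2)%N]mulnC mulnA.
split=> //; apply: (@le_trans _ _ (n%:R * n%:R ^- B + n%:R * n%:R ^- B)).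
  by apply: lerD => //; apply: ler_pM; rewrite ?ler0n ?exprn_ge0 ?invr_ge0 ?half.
have pa0 : 0 < n%:R `^ a :> R by rewrite powR_gt0.
rewrite -mulr2n -[_ *+ 2]mulr_natl mulrA ler_pdivrMr ?exprn_gt0 // mulrAC mul1r.
rewrite ler_pdivlMr // mulrC.
(* The two spare powers of [n] absorb the factor [2 * n <= n ^ 2]. *)
have : n%:R `^ a * n%:R ^+ 2 <= n%:R ^+ B :> R.
  rewrite -!powR_mulrn ?ler0n // -powRD; last by rewrite (gt_eqF n0) implybT.
  apply: ler_powR aB; by rewrite ler1n (ltn_trans _ n2).
apply: le_trans; rewrite ler_wpM2l ?(ltW pa0) // expr2 ler_wpM2r ?(ltW n0) //.
by rewrite ler_nat ltnW.
Qed.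

Lemma cost_bound (c d : R) (k : cost_model) : 0 < c -> 0 < d ->
  exists K : R, forall n, (2 < n)%N ->
    (max_moves c n)%:R <= K * log2 (log2 n%:R) /\
    (rank_cost k * (1 + trunc_log 2 n) +
     max_attempts d n * (attempt_cost k + move_cost k * max_moves c n) +
     flip_cost k * max_moves c n + insert_cost k)%N%:R
      <= K * (log2 n%:R * log2 (log2 n%:R)).
Proof.
move=> c0 d0.
(* Chosen so that [1 <= q * log2 (log2 n)], which absorbs additive constants and the rounding up of
   [max_moves]. *)
pose q : R := (log2 (3 / 2))^-1.
have lam0 : 0 < log2 (3 / 2) :> R by apply: log2_gt0; lra.
have q0 : 0 < q by rewrite invr_gt0.
pose kap := c + q.
pose K0 := (rank_cost k)%:R * (2 * q) +
   (d + 1) * ((attempt_cost k)%:R * q + (move_cost k)%:R * kap) +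
   (flip_cost k)%:R * kap + (insert_cost k)%:R * q.
have kap0 : 0 <= kap by rewrite addr_ge0 // ltW.
have K00 : 0 <= K0.
  by rewrite !addr_ge0 ?mulr_ge0 ?addr_ge0 ?mulr_ge0 ?ler0n ?ler01 // ltW.
exists (kap + K0) => n n2.
have l32 := log2_ge_3_2 R n2; set l := log2 n%:R in l32 *.
have l0 : 0 < l by lra.
have l1 : 1 <= l by lra.
have llam : log2 (3 / 2) <= log2 l by apply: log2_le => //; lra.
have ql : 1 <= q * log2 l by rewrite mulrC ler_pdivlMr // mul1r.
set ll := log2 l in llam ql *.
have ll0 : 0 < ll by apply: lt_le_trans llam.
have jl : (max_moves c n)%:R <= kap * ll.
  have cl0 : 0 <= c * ll by apply: mulr_ge0; apply: ltW.
  by apply: le_trans (natr_ceil_le cl0) _; rewrite mulrDl lerD2l.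
have Al : (max_attempts d n)%:R <= (d + 1) * l.
  have dl0 : 0 <= d * l by apply: mulr_ge0; apply: ltW.
  by apply: le_trans (natr_ceil_le dl0) _; rewrite mulrDl mul1r lerD2l.
have Ll : (trunc_log 2 n)%:R <= l by apply: trunc_log_le_log2; apply: ltn_trans n2.
split; first by apply: le_trans jl _; rewrite ler_pM2r // lerDl.
apply: (@le_trans _ _ (K0 * (l * ll))); last first.
  by rewrite ler_wpM2r ?lerDr // mulr_ge0 // ltW.
have qll : l <= q * (l * ll) by rewrite mulrCA ler_peMr // ltW.
have lll : ll <= l * ll by rewrite ler_peMl // ltW.
rewrite !natrD !natrM !natrD natrM /K0 3!(mulrDl _ _ (l * ll)).
have N0 (i : nat) : 0 <= i%:R :> R by apply: ler0n.
apply: lerD; first apply: lerD; first apply: lerD.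
- rewrite -mulrA; apply: ler_wpM2l => //; rewrite -mulrA mulr_natl mulr2n.
  by apply: le_trans (lerD qll qll); apply: lerD.
- apply: (@le_trans _ _ ((d + 1) * l *
      (((attempt_cost k)%:R * q + (move_cost k)%:R * kap) * ll))).
    apply: ler_pM => //; first by rewrite addr_ge0 ?mulr_ge0.
    rewrite mulrDl -!mulrA; apply: lerD; last exact: ler_wpM2l.
    by rewrite ler_peMr.
  by rewrite mulrACA.
- rewrite -mulrA; apply: ler_wpM2l => //; apply: le_trans jl _.
  by apply: ler_wpM2l.
- rewrite -mulrA ler_peMr //; exact: le_trans qll.
Qed.

End Bounds.

Theorem lemma6 (R : realType) (a : R) (ha : 0 < a) :
  exists c0 d0 : R, [/\ 0 < c0, 0 < d0 &
  forall c d : R, c0 <= c -> d0 <= d ->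
  [/\ forall (V : finType) (e : nat -> V * V) (tie : nat -> bool),
        forms_tree e ->
        1 - 1 / #|V|%:R `^ a <=
          Pr R [set omega : sample c d #|V| |
                 isSome (run e tie (coins omega) #|V|.-1)],
      forall k : cost_model, exists K : R,
        forall (V : finType) (e : nat -> V * V) (tie : nat -> bool)
               (omega : sample c d #|V|) (rank_time : nat -> nat),
        (2 < #|V|)%N -> forms_tree e -> rank_time_ok k e rank_time ->
        isSome (run e tie (coins omega) #|V|.-1) ->
        forall (t : nat) (S S' : state V), (t < #|V|.-1)%N ->
        run e tie (coins omega) t = Some S ->
        run e tie (coins omega) t.+1 = Some S' ->
        (flips S S')%:R <= K * log2 (log2 #|V|%:R) /\
        (step_time k e tie rank_time t (coins omega t) S S')%:R <=
          K * (log2 #|V|%:R * log2 (log2 #|V|%:R))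
    & forall (V : finType) (e : nat -> V * V) (tie : nat -> bool)
             (omega : sample c d #|V|),
        forms_tree e ->
        forall (t : nat) (S : state V), (t <= #|V|.-1)%N ->
        run e tie (coins omega) t = Some S ->
        forall v : V, (outdeg S v <= 3)%N]].
Proof.
(* One spare power of [n] pays for the sum over the steps, the other for adding two failure
   terms. *)
pose B := Num.bound (a + 2).
have aB : a + 2 <= B%:R by rewrite ltW // archi_boundP // addr_ge0 // ltW.
have B0 : 0 < B%:R :> R by apply: lt_le_trans aB; rewrite addr_gt0.
(* The first constant is the exponent for which [2 ^ max_moves], at least that power of [log2 n],
   meets the needs of the union bound; the second makes [2^-1 ^+ max_attempts] at most [n ^- B]. *)
exists (21 + 4 * B)%:R, B%:R; split=> // c d cB dB.
have c0 : 0 < c by apply: lt_le_trans cB; rewrite ltr0n.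
have d0 : 0 < d := lt_le_trans B0 dB.
split.
- move=> V e tie tree; apply: Pr_success.
  case: (leqP #|V| 2) => [n2|n2].
    rewrite (eq_mean (g := fun=> 0)) => [|omega]; last by rewrite run_small.
    by rewrite mean_cst ?card_sample_gt0 // divr_ge0 ?powR_ge0.
  have l32 := log2_ge_3_2 R n2.
  have Ll : (trunc_log 2 #|V|)%:R <= log2 #|V|%:R :> R.
    by apply: trunc_log_le_log2; apply: ltn_trans n2.
  have L0 : (0 < trunc_log 2 #|V|)%N by rewrite trunc_log_gt0 /= (ltn_trans _ n2).
  have [P1 P2] := pow_ge B l32 Ll; have P := pow_max_moves n2 cB.
  have HA : B%:R * log2 #|V|%:R <= (max_attempts d #|V|)%:R :> R.
    have l0 : 0 <= log2 #|V|%:R :> R by apply: le_trans l32; rewrite divr_ge0.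
    apply: (@le_trans _ _ (d * log2 #|V|%:R)); first exact: ler_wpM2r.
    by apply: natr_ceil_ge; apply: mulr_ge0 => //; apply: ltW.
  have [j0 x1] := union_bound n2 L0 aB (le_trans P1 P) (le_trans P2 P) HA.
  apply: le_trans.
  rewrite (eq_mean (g := fun omega : sample c d #|V| =>
    (~~ isSome (run_from e tie 0 (@init V)
       [seq [seq val b | b <- val cs] | cs <- val omega]))%:R)).
    apply: le_trans (mean_failure tree _ L0 j0 x1 (add0n _) (wf_init e tie)) _.
    rewrite lerD2r ler_wpM2r ?invr_ge0 ?exprn_ge0 ?(le_trans _ x1) //.
    exact: potential_init.
  by move=> omega; rewrite run_coinsE.
- move=> k; have [K HK] := cost_bound k c0 d0; exists K.
  move=> V e tie omega rank_time n2 tree rk _ t S S' tm Et Et'.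
  have [H1 H2] := HK _ n2; split.
    by apply: le_trans H1; rewrite ler_nat (flips_le tree tm Et Et').
  by apply: le_trans H2; rewrite ler_nat (step_time_le tree tm rk Et Et').
- move=> V e tie omega tree t S tm Et v.
  exact: wf_out (wf_run tree tm Et) v.
Qed.
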